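(* Let $G$ be a finite group acting linearly on a finite-dimensional complex vector space $V$, and let $M$ be a quasianalytic DC-weight sequence. Let $c:(\mathbb{R},0)\to V/\!\!/G=\sigma(V)\subseteq\mathbb{C}^n$ be a germ of a $C^M$ curve. If $\bar c:(\mathbb{R},0)\to V$ is a $C^\infty$ germ with $\sigma\circ\bar c=c$, then $\bar c$ is a $C^M$ germ.
   Context: $\sigma=(\sigma_1,\dots,\sigma_n)$ for homogeneous generators $\sigma_1,\dots,\sigma_n$ of $\mathbb{C}[V]^G$; $V/\!\!/G$ is identified with $\sigma(V)\subseteq\mathbb{C}^n$. A DC-weight sequence is a non-decreasing sequence $M=(M_k)_{k\in\mathbb{N}}$ of positive reals with $M_0=1$, $M_k^2\le M_{k-1}M_{k+1}$ for $k\ge1$ and $\sup_{k\ge1}(M_{k+1}/M_k)^{1/k}<\infty$; it is quasianalytic if $\sum_{k\ge1}(k!M_k)^{-1/k}=\infty$. For $U\subseteq\mathbb{R}$ open, $C^M(U)$ consists of $f\in C^\infty(U)$ such that for every compact $K\subseteq U$ there are $C,\rho>0$ with $|f^{(k)}(x)|\le C\rho^k k!M_k$ for all $k$ and $x\in K$; complex- or vector-valued maps are $C^M$ if all real and imaginary parts of their components are. *)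

(* Defs.v *)
From mathcomp Require Import all_boot all_fingroup.
From Stdlib Require Import Reals Rtopology.

Definition Cplx : Type := (R * R)%type.
Definition C0 : Cplx := (0%R, 0%R).
Definition C1 : Cplx := (1%R, 0%R).
Definition Cadd (z w : Cplx) : Cplx := (fst z + fst w, snd z + snd w)%R.
Definition Cmul (z w : Cplx) : Cplx :=
  (fst z * fst w - snd z * snd w, fst z * snd w + snd z * fst w)%R.
Fixpoint Cpow (z : Cplx) (k : nat) : Cplx :=
  match k with O => C1 | S k' => Cmul z (Cpow z k') end.
Fixpoint Csum (m : nat) (f : nat -> Cplx) : Cplx :=
  match m with O => C0 | S m' => Cadd (Csum m' f) (f m') end.

Inductive cpoly : Type :=
| PC : Cplx -> cpoly
| PX : nat -> cpoly
| PAdd : cpoly -> cpoly -> cpoly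
| PMul : cpoly -> cpoly -> cpoly.

Fixpoint peval (x : nat -> Cplx) (p : cpoly) : Cplx :=
  match p with
  | PC c => c
  | PX i => x i
  | PAdd p q => Cadd (peval x p) (peval x q)
  | PMul p q => Cmul (peval x p) (peval x q)
  end.

Fixpoint pvars_lt (d : nat) (p : cpoly) : Prop :=
  match p with
  | PC _ => True
  | PX i => (i < d)%N
  | PAdd p q => pvars_lt d p /\ pvars_lt d q
  | PMul p q => pvars_lt d p /\ pvars_lt d q
  end.

Definition homogeneous (p : cpoly) : Prop :=
  exists k : nat, forall (t : Cplx) (x : nat -> Cplx),
    peval (fun i => Cmul t (x i)) p = Cmul (Cpow t k) (peval x p).

Definition act {gT : finGroupType} (d : nat) (rho : gT -> nat -> nat -> Cplx)
  (g : gT) (v : nat -> Cplx) : nat -> Cplx :=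
  fun i => Csum d (fun j => Cmul (rho g i j) (v j)).

Definition linear_action {gT : finGroupType} (d : nat)
  (rho : gT -> nat -> nat -> Cplx) : Prop :=
  (forall (v : nat -> Cplx) (i : nat), (i < d)%N -> act d rho 1%g v i = v i) /\
  (forall (g h : gT) (v : nat -> Cplx) (i : nat), (i < d)%N ->
     act d rho (g * h)%g v i = act d rho g (act d rho h v) i).

Definition invariant {gT : finGroupType} (d : nat)
  (rho : gT -> nat -> nat -> Cplx) (p : cpoly) : Prop :=
  pvars_lt d p /\ forall (g : gT) (x : nat -> Cplx), peval (act d rho g x) p = peval x p.

Definition hilbert_basis {gT : finGroupType} (d : nat)
  (rho : gT -> nat -> nat -> Cplx) (n : nat) (sigma : nat -> cpoly) : Prop :=
  (forall j, (j < n)%N -> invariant d rho (sigma j) /\ homogeneous (sigma j)) /\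
  (forall p, invariant d rho p ->
     exists q, pvars_lt n q /\
       forall x : nat -> Cplx, peval x p = peval (fun j => peval x (sigma j)) q).

Definition DC_weight (M : nat -> R) : Prop :=
  M 0%nat = 1%R /\
  (forall k, (0 < M k)%R) /\
  (forall k, (M k <= M (S k))%R) /\
  (forall k, (1 <= k)%N -> (M k ^ 2 <= M (k - 1)%nat * M (S k))%R) /\
  (exists B : R, forall k, (1 <= k)%N ->
     (Rpower (M (S k) / M k) (/ INR k) <= B)%R).

Definition quasianalytic (M : nat -> R) : Prop :=
  forall B : R, exists N : nat,
    (B < sum_f_R0 (fun i => Rpower (INR (Factorial.fact (S i)) * M (S i)) (- / INR (S i))) N)%R.

Definition derivs_on (U : R -> Prop) (f : R -> R) (D : nat -> R -> R) : Prop :=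
  (forall x, U x -> D 0%nat x = f x) /\
  (forall (k : nat) (x : R), U x -> derivable_pt_lim (D k) x (D (S k) x)).

Definition Cinf_on (U : R -> Prop) (f : R -> R) : Prop :=
  exists D, derivs_on U f D.

Definition CM_on (M : nat -> R) (U : R -> Prop) (f : R -> R) : Prop :=
  exists D, derivs_on U f D /\
    forall K : R -> Prop, included K U -> compact K ->
      exists Cc rho : R, (0 < Cc)%R /\ (0 < rho)%R /\
        forall (k : nat) (x : R), K x ->
          (Rabs (D k x) <= Cc * rho ^ k * INR (Factorial.fact k) * M k)%R.

Definition Cinf_vec (U : R -> Prop) (m : nat) (c : R -> nat -> Cplx) : Prop :=
  forall j, (j < m)%N ->
    Cinf_on U (fun t => fst (c t j)) /\ Cinf_on U (fun t => snd (c t j)).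

Definition CM_vec (M : nat -> R) (U : R -> Prop) (m : nat) (c : R -> nat -> Cplx) : Prop :=
  forall j, (j < m)%N ->
    CM_on M U (fun t => fst (c t j)) /\ CM_on M U (fun t => snd (c t j)).

Definition sym_interval (e : R) : R -> Prop := fun t => (- e < t < e)%R.

(* Main.v *)
Require Import Defs.
From Stdlib Require Import Reals Lra Lia Factorial Classical.
From Stdlib Require Import FunctionalExtensionality IndefiniteDescription.
From Coquelicot Require Import Coquelicot.
From Stdlib Require Import List Permutation.
Local Open Scope R_scope.

(* Every coordinate f of the lift is a root of the monic polynomial with roots
   f_g = (coordinate of g.cbar), g in G; its coefficients are invariant, hence
   polynomials in c, hence of class C^M.  A smooth flat root w of a monic polynomial
   over C^M vanishes near 0: by the Denjoy-Carleman theorem the flat coefficients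
   vanish, so a power of w can be split off until the constant coefficient has finite
   order at 0, which is impossible unless w = 0.  Applied to the orbit of f_g - f, this
   shows that f_g - f either vanishes or has finite order at 0.  If e of the f_g equal f,
   then Q = (d/dz)^(e-1) P satisfies Q(f) = 0 and dQ/dz (f) = t^k u with u(0) <> 0.
   Writing f = T + t^k h with T a Taylor polynomial of f, Q(f) = 0 becomes an equation
   over C^M with simple root h, and h is C^M because it satisfies a polynomial
   differential equation over C^M. *)

(** * Weights and jets *)

(** The obstacle is coincidence of roots: if several f_g equal f identically, dP/dz vanishes along f
    and no implicit function argument applies to P itself, so the differences of roots have to be
    understood first. Quasianalyticity is spent at that point. What follows uses closure of C^M
    under sums, products, derivatives, division by t and solution of polynomial differential
    equations. The last closure property dictates the bookkeeping. Bounds have the form A * b^k *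
    [W M k], for derivatives divided by k! and with [W M k] = M k / (k+1)^2. The square keeps the
    convolution of [W M] with itself below 8 [W M], so that a product changes A but not b. In a
    differential equation the amplitude of the right-hand side is then independent of b, and one
    integration, which gains a factor 1/b, restores the initial amplitude once b is large. Complex
    functions are pairs of real ones, and a complex inverse enters through the real unknown 1/|w|^2,
    which keeps all right-hand sides polynomial. *)

Record weight (M : nat -> R) : Prop := {
  weight_0 : M 0%nat = 1;
  weight_pos : forall k, 0 < M k;
  weight_incr : forall k, M k <= M (S k);
  weight_convex : forall k, M (S k) ^ 2 <= M k * M (S (S k));
  weight_shift : exists B, 1 <= B /\ forall k, M (S k) <= B ^ S k * M k }.

(** Log-convexity iterated [j] times: the quotients M(i+1)/M(i) increase with i, in cross-multiplied
    form. *)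
Lemma weight_ratio_incr M : weight M -> forall j k,
  M (S k) * M (k + j)%nat <= M k * M (S (k + j)).
Proof.
intros HM j k; induction j as [|j IH].
{ rewrite Nat.add_0_r; lra. }
rewrite Nat.add_succ_r.
pose proof (weight_pos M HM) as Hp.
pose proof (weight_convex M HM (k + j)) as Hc.
pose proof (Hp k); pose proof (Hp (S k)); pose proof (Hp (k + j)%nat).
pose proof (Hp (S (k + j))); pose proof (Hp (S (S (k + j)))).
apply Rmult_le_reg_r with (M (k + j)%nat); [easy|].
apply Rle_trans with (M k * M (S (k + j)) * M (S (k + j))); nra.
Qed.

(** From M(0) = 1 on, passing from j to j+1 multiplies the left side by M(j+1)/M(j) and the right
    side by the larger quotient M(j+k+1)/M(j+k). *)
Lemma weight_mult M : weight M -> forall j k, M j * M k <= M (j + k)%nat.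
Proof.
intros HM j; induction j as [|j IH]; intros k.
{ rewrite (weight_0 M HM); simpl; lra. }
pose proof (weight_pos M HM) as Hp.
pose proof (Hp k); pose proof (Hp j); pose proof (Hp (S j)).
pose proof (weight_ratio_incr M HM k j) as Hr.
specialize (IH k).
apply Rmult_le_reg_l with (M j); [easy|].
simpl plus.
apply Rle_trans with (M (S j) * M (j + k)%nat); [nra|easy].
Qed.

(** The factor 1/(k+1)^2 is stable under convolution up to a constant, which makes bounds by [W M]
    multiplicative; it costs only a geometric factor, so [W M] and [M] define the same class. *)
Definition W (M : nat -> R) (k : nat) : R := M k / INR (S k) ^ 2.

Lemma INR_S_pos k : 0 < INR (S k).
Proof. apply lt_0_INR; lia. Qed.

Lemma W_pos M : weight M -> forall k, 0 < W M k.
Proof.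
intros HM k; apply Rdiv_lt_0_compat; [apply weight_pos, HM|].
apply pow_lt, INR_S_pos.
Qed.

Lemma W_le M : weight M -> forall k, W M k <= M k.
Proof.
intros HM k; unfold W; pose proof (weight_pos M HM k) as Hp.
assert (1 <= INR (S k)) by (rewrite S_INR; pose proof (pos_INR k); lra).
apply Rmult_le_reg_r with (INR (S k) ^ 2); [nra|].
unfold Rdiv; rewrite Rmult_assoc, Rinv_l by (apply pow_nonzero; lra).
apply Rmult_le_compat_l; nra.
Qed.

(** The 4 bounds ((k+2)/(k+1))^2. Integration compares orders k and k+1 in this way. *)
Lemma W_step M : weight M -> forall k, W M k <= 4 * W M (S k).
Proof.
intros HM k; unfold W.
pose proof (weight_pos M HM k); pose proof (weight_incr M HM k) as Hi.
rewrite !(S_INR (S k)); pose proof (INR_S_pos k) as Hk.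
assert (1 <= INR (S k)) by (rewrite S_INR; pose proof (pos_INR k); lra).
set (x := INR (S k)) in *.
apply Rle_trans with (4 * (M k / (x + 1) ^ 2)).
- apply Rmult_le_reg_r with (x ^ 2 * (x + 1) ^ 2); [nra|].
  replace (M k / x ^ 2 * (x ^ 2 * (x + 1) ^ 2)) with (M k * (x + 1) ^ 2)
    by (field; nra).
  replace (4 * (M k / (x + 1) ^ 2) * (x ^ 2 * (x + 1) ^ 2)) with
    (M k * (4 * x ^ 2)) by (field; nra).
  apply Rmult_le_compat_l; nra.
- apply Rmult_le_compat_l; [lra|].
  apply Rmult_le_compat_r; [|easy].
  left; apply Rinv_0_lt_compat; nra.
Qed.

Lemma INR_S_le_pow2 k : INR (S k) <= 2 ^ k.
Proof.
induction k as [|k IH]; [simpl; lra|].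
rewrite S_INR; simpl pow.
assert (1 <= 2 ^ k) by (apply pow_R1_Rle; lra).
lra.
Qed.

(** Differentiation and division by x shift the jet by one order and produce a factor k+1, at most
    2^k; both are absorbed in the geometric rate. *)
Lemma W_shift M : weight M ->
  exists B, 1 <= B /\ forall k, INR (S k) * W M (S k) <= B ^ S k * W M k.
Proof.
intros HM; destruct (weight_shift M HM) as [B [HB1 HB]].
exists (2 * B); split; [lra|]; intros k.
pose proof (weight_pos M HM k); pose proof (weight_pos M HM (S k)).
pose proof (INR_S_pos k) as Hk; pose proof (INR_S_le_pow2 k) as H2.
rewrite Rpow_mult_distr; unfold W; specialize (HB k).
assert (Hq : M (S k) / INR (S (S k)) ^ 2 <= M (S k) / INR (S k) ^ 2).
{ apply Rmult_le_compat_l; [lra|].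
  apply Rinv_le_contravar; [apply pow_lt, Hk|].
  rewrite (S_INR (S k)); nra. }
assert (Hq2 : M (S k) / INR (S k) ^ 2 <= B ^ S k * (M k / INR (S k) ^ 2)).
{ replace (B ^ S k * (M k / INR (S k) ^ 2)) with (B ^ S k * M k / INR (S k) ^ 2)
    by (field; lra).
  apply Rmult_le_compat_r; [|easy].
  left; apply Rinv_0_lt_compat, pow_lt, Hk. }
assert (0 < M k / INR (S k) ^ 2) by (apply Rdiv_lt_0_compat; [easy|apply pow_lt, Hk]).
assert (0 < M (S k) / INR (S (S k)) ^ 2).
{ apply Rdiv_lt_0_compat; [easy|apply pow_lt, INR_S_pos]. }
rewrite Rmult_assoc; apply Rmult_le_compat; try lra.
simpl pow; assert (1 <= 2 ^ k) by (apply pow_R1_Rle; lra); lra.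
Qed.

Lemma sum_inv_square n : sum_f_R0 (fun j => / INR (S j) ^ 2) n <= 2 - / INR (S n).
Proof.
induction n as [|n IH]; [simpl; rewrite !Rmult_1_r, Rinv_1; lra|].
rewrite tech5.
assert (H : / INR (S (S n)) ^ 2 <= / INR (S n) - / INR (S (S n))).
{ rewrite (S_INR (S n)); pose proof (INR_S_pos n) as Hn; set (x := INR (S n)) in *.
  apply Rmult_le_reg_r with (x * (x + 1) ^ 2); [nra|].
  replace (/ (x + 1) ^ 2 * (x * (x + 1) ^ 2)) with x by (field; nra).
  replace ((/ x - / (x + 1)) * (x * (x + 1) ^ 2)) with (x + 1) by (field; nra).
  lra. }
lra.
Qed.

Lemma sum_rev (f : nat -> R) n :
  sum_f_R0 (fun j => f (n - j)%nat) n = sum_f_R0 f n.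
Proof.
induction n as [|n IH]; [reflexivity|].
rewrite decomp_sum by lia; simpl pred.
rewrite (tech5 f), <- IH, Rplus_comm; f_equal.
Qed.

(* With a = j+1 and b = k-j+1 one has 1/(a b) = (1/a + 1/b)/(k+2). *)
Lemma sum_inv_square_conv k :
  sum_f_R0 (fun j => / INR (S j) ^ 2 * / INR (S (k - j)) ^ 2) k <= 8 / INR (S k) ^ 2.
Proof.
pose proof (INR_S_pos k) as Hk.
apply Rle_trans with
  (sum_f_R0 (fun j => (/ INR (S j) ^ 2 + / INR (S (k - j)) ^ 2) * (2 / INR (S k) ^ 2)) k).
- apply sum_Rle; intros j Hj.
  pose proof (INR_S_pos j) as Ha; pose proof (INR_S_pos (k - j)) as Hb.
  assert (Hab : INR (S j) + INR (S (k - j)) = INR (S k) + 1).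
  { rewrite !S_INR, minus_INR by easy; ring. }
  set (a := INR (S j)) in *; set (b := INR (S (k - j))) in *; set (c := INR (S k)) in *.
  apply Rmult_le_reg_r with (a ^ 2 * b ^ 2 * c ^ 2).
  { repeat apply Rmult_lt_0_compat; lra. }
  replace (/ a ^ 2 * / b ^ 2 * (a ^ 2 * b ^ 2 * c ^ 2)) with (c ^ 2) by (field; lra).
  replace ((/ a ^ 2 + / b ^ 2) * (2 / c ^ 2) * (a ^ 2 * b ^ 2 * c ^ 2)) with
    (2 * (a ^ 2 + b ^ 2)) by (field; lra).
  replace c with (a + b - 1) by lra.
  pose proof (pow2_ge_0 (a - b)).
  assert (1 <= a + b) by lra.
  nra.
- rewrite <- scal_sum, sum_plus.
  rewrite (sum_rev (fun j => / INR (S j) ^ 2)).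
  pose proof (sum_inv_square k) as Hs.
  assert (0 < / INR (S k)) by (apply Rinv_0_lt_compat; easy).
  replace (8 / INR (S k) ^ 2) with (2 / INR (S k) ^ 2 * 4) by (field; lra).
  apply Rmult_le_compat_l; [|lra].
  left; apply Rdiv_lt_0_compat; [lra|apply pow_lt, Hk].
Qed.

Lemma W_conv M : weight M -> forall k,
  sum_f_R0 (fun j => W M j * W M (k - j)%nat) k <= 8 * W M k.
Proof.
intros HM k; pose proof (weight_pos M HM k) as Hp.
apply Rle_trans with
  (sum_f_R0 (fun j => / INR (S j) ^ 2 * / INR (S (k - j)) ^ 2 * M k) k).
- apply sum_Rle; intros j Hj; unfold W.
  pose proof (weight_mult M HM j (k - j)) as Hm.
  replace (j + (k - j))%nat with k in Hm by lia.
  pose proof (pow_lt _ 2 (INR_S_pos j)) as Ha.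
  pose proof (pow_lt _ 2 (INR_S_pos (k - j))) as Hb.
  apply Rinv_0_lt_compat in Ha; apply Rinv_0_lt_compat in Hb.
  unfold Rdiv.
  replace (M j * / INR (S j) ^ 2 * (M (k - j)%nat * / INR (S (k - j)) ^ 2)) with
    (/ INR (S j) ^ 2 * / INR (S (k - j)) ^ 2 * (M j * M (k - j)%nat)) by ring.
  apply Rmult_le_compat_l; [|easy].
  apply Rmult_le_pos; lra.
- rewrite <- scal_sum; unfold W.
  replace (8 * (M k / INR (S k) ^ 2)) with (M k * (8 / INR (S k) ^ 2))
    by (unfold Rdiv; ring).
  apply Rmult_le_compat_l; [lra|apply sum_inv_square_conv].
Qed.

(* [d k] is the normalised derivative f^(k)/k!, so that products of functions
   correspond to Cauchy products of jets. *)
Definition jet (r : R) (K : nat) (f : R -> R) (d : nat -> R -> R) : Prop :=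
  (forall x, Rabs x < r -> d 0%nat x = f x) /\
  (forall k x, (k < K)%nat -> Rabs x < r -> is_derive (d k) x (INR (S k) * d (S k) x)).

Definition smooth (r : R) (f : R -> R) : Prop := forall K, exists d, jet r K f d.

Definition jet_bound (M : nat -> R) (r : R) (K : nat) (f : R -> R) (A b : R) : Prop :=
  exists d, jet r K f d /\
    forall k x, (k <= K)%nat -> Rabs x < r -> Rabs (d k x) <= A * b ^ k * W M k.

(** [A] and [b] precede [K]: each order may have its own jet, but the bounds are uniform. Membership
    can thus be proved by induction on [K], and [jet_unique] makes the jets agree. *)
Definition cm (M : nat -> R) (r : R) (f : R -> R) : Prop :=
  exists A b, 0 <= A /\ 1 <= b /\ forall K, jet_bound M r K f A b.

Lemma cm_smooth M r f : cm M r f -> smooth r f.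
Proof.
intros (A & b & _ & _ & H) K; destruct (H K) as (d & Hd & _); exists d; exact Hd.
Qed.

Lemma locally_Rabs_lt x r : Rabs x < r -> locally x (fun y => Rabs y < r).
Proof.
intros Hx; assert (He : 0 < r - Rabs x) by lra.
assert (Ht : forall y : R, Rabs (y - x) < r - Rabs x -> Rabs y < r).
{ intros y Hy; pose proof (Rabs_triang (y - x) x) as Ht.
  replace (y - x + x) with y in Ht by ring; lra. }
exists (mkposreal _ He); intros y Hy; apply Ht, Hy.
Qed.

Lemma is_derive_eq_on r (f g : R -> R) x l :
  (forall y, Rabs y < r -> f y = g y) -> Rabs x < r -> is_derive f x l -> is_derive g x l.
Proof.
intros Hfg Hx; apply is_derive_ext_loc.
generalize (locally_Rabs_lt x r Hx); apply filter_imp; exact Hfg.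
Qed.

Lemma jet_unique r K f d e : jet r K f d -> jet r K f e ->
  forall k x, (k <= K)%nat -> Rabs x < r -> d k x = e k x.
Proof.
intros [Hd0 Hd] [He0 He] k; induction k as [|k IH]; intros x Hk Hx.
{ now rewrite Hd0, He0. }
pose proof (Hd k x Hk Hx) as H1.
apply (is_derive_eq_on r _ (e k)) in H1; [|intros y Hy; apply IH; [lia|easy]|easy].
pose proof (He k x Hk Hx) as H2.
apply is_derive_unique in H1; apply is_derive_unique in H2.
rewrite H1 in H2; pose proof (INR_S_pos k).
apply Rmult_eq_reg_l in H2; lra.
Qed.

Lemma jet_le r r' K K' f d : r' <= r -> (K' <= K)%nat -> jet r K f d -> jet r' K' f d.
Proof.
intros Hr HK [H0 H]; split; intros; [apply H0; lra|apply H; [lia|lra]].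
Qed.

Lemma jet_ext r K f g d : (forall x, Rabs x < r -> f x = g x) -> jet r K f d -> jet r K g d.
Proof.
intros Hfg [H0 H]; split; [|exact H]; intros x Hx; rewrite H0, Hfg; easy.
Qed.

Lemma jet_plus r K f g d e : jet r K f d -> jet r K g e ->
  jet r K (fun x => f x + g x) (fun k x => d k x + e k x).
Proof.
intros [Hd0 Hd] [He0 He]; split; intros.
- now rewrite Hd0, He0.
- rewrite Rmult_plus_distr_l; apply (is_derive_plus (d k) (e k)); auto.
Qed.

Definition conv (d e : nat -> R -> R) (k : nat) (x : R) : R :=
  sum_f_R0 (fun j => d j x * e (k - j)%nat x) k.

Lemma is_derive_sum (f : nat -> R -> R) (l : nat -> R) x n :
  (forall j, (j <= n)%nat -> is_derive (f j) x (l j)) ->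
  is_derive (fun y => sum_f_R0 (fun j => f j y) n) x (sum_f_R0 l n).
Proof.
induction n as [|n IH]; intros H; simpl; [apply H; lia|].
apply (is_derive_plus (fun y => sum_f_R0 (fun j => f j y) n) (f (S n))); auto.
Qed.

(** After reindexing, the term a_j * b_(k+1-j) carries weight j from one half and k+1-j from the
    other, in total always k+1. *)
Lemma conv_leibniz (a b : nat -> R) k :
  sum_f_R0 (fun j => INR (S j) * a (S j) * b (k - j)%nat +
                     a j * (INR (S (k - j)) * b (S (k - j)))) k
  = INR (S k) * sum_f_R0 (fun j => a j * b (S k - j)%nat) (S k).
Proof.
rewrite sum_plus.
assert (H1 : sum_f_R0 (fun j => INR (S j) * a (S j) * b (k - j)%nat) k =
             sum_f_R0 (fun j => INR j * (a j * b (S k - j)%nat)) (S k)).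
{ rewrite (decomp_sum _ (S k)) by lia; simpl pred.
  rewrite Rmult_0_l, Rplus_0_l; apply sum_eq; intros i Hi.
  rewrite Rmult_assoc; reflexivity. }
assert (H2 : sum_f_R0 (fun j => a j * (INR (S (k - j)) * b (S (k - j)))) k =
             sum_f_R0 (fun j => INR (S k - j) * (a j * b (S k - j)%nat)) (S k)).
{ rewrite (tech5 _ k), Nat.sub_diag, Rmult_0_l, Rplus_0_r; apply sum_eq; intros i Hi.
  replace (S k - i)%nat with (S (k - i)) by lia; ring. }
rewrite H1, H2, <- sum_plus, scal_sum; apply sum_eq; intros i Hi.
rewrite minus_INR by easy; ring.
Qed.

Lemma jet_mult r K f g d e : jet r K f d -> jet r K g e ->
  jet r K (fun x => f x * g x) (conv d e).
Proof.
intros [Hd0 Hd] [He0 He]; split.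
- intros x Hx; unfold conv; simpl; now rewrite Hd0, He0.
- intros k x Hk Hx; unfold conv; rewrite <- (conv_leibniz (fun j => d j x) (fun j => e j x)).
  apply (is_derive_sum (fun j y => d j y * e (k - j)%nat y)).
  intros j Hj; apply Derive.is_derive_mult; [apply Hd|apply He]; try lia; easy.
Qed.

Lemma jet_const r K c : jet r K (fun _ => c) (fun k _ => match k with O => c | S _ => 0 end).
Proof.
split; [reflexivity|]; intros [|k] x _ _; rewrite Rmult_0_r; apply (is_derive_const (V := R_NormedModule)).
Qed.

Lemma jet_id r K : jet r K (fun x => x)
  (fun k x => match k with O => x | S O => 1 | S (S _) => 0 end).
Proof.
split; [reflexivity|]; intros [|[|k]] x _ _.
- replace (INR 1 * 1) with 1 by (simpl; ring); apply (is_derive_id (K := R_AbsRing)).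
- rewrite Rmult_0_r; apply (is_derive_const (V := R_NormedModule)).
- rewrite Rmult_0_r; apply (is_derive_const (V := R_NormedModule)).
Qed.

Lemma smooth_le r r' f : r' <= r -> smooth r f -> smooth r' f.
Proof.
intros Hr H K; destruct (H K) as [d Hd]; exists d.
now apply (jet_le r r' K K).
Qed.

Lemma smooth_plus r f g : smooth r f -> smooth r g -> smooth r (fun x => f x + g x).
Proof.
intros Hf Hg K; destruct (Hf K) as [d Hd]; destruct (Hg K) as [e He].
eexists; apply jet_plus; eassumption.
Qed.

Lemma smooth_mult r f g : smooth r f -> smooth r g -> smooth r (fun x => f x * g x).
Proof.
intros Hf Hg K; destruct (Hf K) as [d Hd]; destruct (Hg K) as [e He].
eexists; apply jet_mult; eassumption.
Qed.

Lemma jet_bound_mono M r K f A b A' b' : weight M ->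
  0 <= A -> A <= A' -> 1 <= b -> b <= b' ->
  jet_bound M r K f A b -> jet_bound M r K f A' b'.
Proof.
intros HM HA HA' Hb Hb' (d & Hd & Hbd); exists d; split; [easy|]; intros k x Hk Hx.
eapply Rle_trans; [apply Hbd; easy|].
pose proof (W_pos M HM k).
apply Rmult_le_compat_r; [lra|].
apply Rmult_le_compat; try lra; [apply pow_le; lra|apply pow_incr; lra].
Qed.

Lemma jet_bound_le M r r' K K' f A b : r' <= r -> (K' <= K)%nat ->
  jet_bound M r K f A b -> jet_bound M r' K' f A b.
Proof.
intros Hr HK (d & Hd & Hbd); exists d; split; [now apply (jet_le r r' K)|].
intros k x Hk Hx; apply Hbd; [lia|lra].
Qed.

Lemma jet_bound_plus M r K f g A A' b :
  jet_bound M r K f A b -> jet_bound M r K g A' b ->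
  jet_bound M r K (fun x => f x + g x) (A + A') b.
Proof.
intros (d & Hd & Hbd) (e & He & Hbe).
exists (fun k x => d k x + e k x); split; [now apply jet_plus|]; intros k x Hk Hx.
eapply Rle_trans; [apply Rabs_triang|].
rewrite !Rmult_plus_distr_r; apply Rplus_le_compat; auto.
Qed.

(** The rate [b] survives unchanged and only the amplitudes multiply; [cm_ode] rests on this. *)
Lemma jet_bound_mult M r K f g A A' b : weight M -> 0 <= A -> 0 <= A' -> 1 <= b ->
  jet_bound M r K f A b -> jet_bound M r K g A' b ->
  jet_bound M r K (fun x => f x * g x) (8 * A * A') b.
Proof.
intros HM HA HA' Hb (d & Hd & Hbd) (e & He & Hbe).
exists (conv d e); split; [now apply jet_mult|]; intros k x Hk Hx.
unfold conv; eapply Rle_trans; [apply sum_f_R0_triangle|].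
apply Rle_trans with
  (sum_f_R0 (fun j => W M j * W M (k - j)%nat * (A * A' * b ^ k)) k).
- apply sum_Rle; intros j Hj; rewrite Rabs_mult.
  replace (b ^ k) with (b ^ j * b ^ (k - j)) by (rewrite <- pow_add; f_equal; lia).
  replace (W M j * W M (k - j)%nat * (A * A' * (b ^ j * b ^ (k - j)))) with
    (A * b ^ j * W M j * (A' * b ^ (k - j) * W M (k - j)%nat)) by ring.
  apply Rmult_le_compat; try apply Rabs_pos; [apply Hbd|apply Hbe]; try lia; easy.
- rewrite <- scal_sum.
  replace (8 * A * A' * b ^ k * W M k) with (A * A' * b ^ k * (8 * W M k)) by ring.
  apply Rmult_le_compat_l; [|now apply W_conv].
  apply Rmult_le_pos; [nra|apply pow_le; lra].
Qed.

Lemma cm_le M r r' f : r' <= r -> cm M r f -> cm M r' f.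
Proof.
intros Hr (A & b & HA & Hb & H); exists A, b; repeat split; try easy; intros K.
apply (jet_bound_le M r r' K K); auto.
Qed.

Lemma cm_ext M r f g : (forall x, Rabs x < r -> f x = g x) -> cm M r f -> cm M r g.
Proof.
intros E (A & b & HA & Hb & H); exists A, b; repeat split; try easy; intros K.
destruct (H K) as (d & Hd & Hbd); exists d; split; [now apply (jet_ext r K f)|easy].
Qed.

Lemma cm_plus M r f g : weight M -> cm M r f -> cm M r g -> cm M r (fun x => f x + g x).
Proof.
intros HM (A & b & HA & Hb & H) (A' & b' & HA' & Hb' & H').
pose proof (Rmax_l b b'); pose proof (Rmax_r b b').
exists (A + A'), (Rmax b b'); repeat split; try lra; intros K; apply jet_bound_plus.
- apply (jet_bound_mono M r K f A b); auto; lra.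
- apply (jet_bound_mono M r K g A' b'); auto; lra.
Qed.

Lemma cm_mult M r f g : weight M -> cm M r f -> cm M r g -> cm M r (fun x => f x * g x).
Proof.
intros HM (A & b & HA & Hb & H) (A' & b' & HA' & Hb' & H').
pose proof (Rmax_l b b'); pose proof (Rmax_r b b').
exists (8 * A * A'), (Rmax b b'); repeat split; try lra; [nra|].
intros K; apply jet_bound_mult; auto; try lra.
- apply (jet_bound_mono M r K f A b); auto; lra.
- apply (jet_bound_mono M r K g A' b'); auto; lra.
Qed.

Lemma W_0 M : weight M -> W M 0 = 1.
Proof. intros HM; unfold W; rewrite (weight_0 M HM); simpl; field. Qed.

Lemma cm_const M r c : weight M -> cm M r (fun _ => c).
Proof.
intros HM; exists (Rabs c), 1; repeat split; try lra; [apply Rabs_pos|].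
intros K; eexists; split; [apply jet_const|]; intros [|k] x _ _; cbn beta iota.
- rewrite W_0 by easy; simpl; lra.
- rewrite Rabs_R0; pose proof (W_pos M HM (S k)); pose proof (Rabs_pos c).
  rewrite pow1; nra.
Qed.

Lemma cm_id M r : weight M -> cm M r (fun x => x).
Proof.
(* The amplitude must dominate Rabs x < r at order 0 and the derivative 1 at order 1, where the
   bound is A * [W M 1]. *)
intros HM; exists (Rmax (Rabs r) (/ W M 1)), 1.
pose proof (Rmax_l (Rabs r) (/ W M 1)); pose proof (Rmax_r (Rabs r) (/ W M 1)).
pose proof (Rabs_pos r); pose proof (Rle_abs r).
repeat split; try lra.
intros K; eexists; split; [apply jet_id|]; intros [|[|k]] x _ Hx; cbn beta iota.
- rewrite W_0 by easy; simpl; lra.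
- pose proof (W_pos M HM 1) as Hw; rewrite pow1, Rabs_R1, Rmult_1_r.
  rewrite <- (Rinv_l (W M 1)) by lra; apply Rmult_le_compat_r; lra.
- rewrite Rabs_R0; pose proof (W_pos M HM (S (S k))); rewrite pow1; nra.
Qed.

Lemma cm_derive M r f : weight M -> cm M r f ->
  exists f', cm M r f' /\ forall x, Rabs x < r -> is_derive f x (f' x).
Proof.
intros HM (A & b & HA & Hb & H).
destruct (W_shift M HM) as (B & HB & HW).
destruct (H 1%nat) as (d1 & [Hd10 Hd1] & _).
(* The derivative is read off one jet of order 1; [jet_unique] identifies it with the one from each
   longer jet. *)
exists (d1 1%nat); split.
- exists (A * b * B), (b * B); repeat split; [repeat apply Rmult_le_pos; lra|nra|]; intros K.
  destruct (H (S K)) as (d & Hd & Hbd).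
  exists (fun k x => INR (S k) * d (S k) x); split; [split|].
  + intros x Hx; replace (INR 1) with 1 by reflexivity; rewrite Rmult_1_l.
    apply (jet_unique r 1 f); try lia; try easy.
    apply (jet_le r r (S K)); [lra|lia|easy].
  + intros k x Hk Hx; destruct Hd as [Hd0 Hd].
    apply (is_derive_scal (d (S k)) x (INR (S k))), Hd; [lia|easy].
  + intros k x Hk Hx; rewrite Rabs_mult, Rabs_pos_eq by (apply pos_INR).
    pose proof (Hbd (S k) x (le_n_S _ _ Hk) Hx) as Hb'.
    pose proof (INR_S_pos k).
    eapply Rle_trans; [apply Rmult_le_compat_l; [lra|exact Hb']|].
    replace (INR (S k) * (A * b ^ S k * W M (S k))) with
      (A * b ^ S k * (INR (S k) * W M (S k))) by ring.
    replace (A * b * B * (b * B) ^ k * W M k) with (A * b ^ S k * (B ^ S k * W M k))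
      by (rewrite Rpow_mult_distr; simpl; ring).
    apply Rmult_le_compat_l; [|apply HW].
    apply Rmult_le_pos; [easy|apply pow_le; lra].
- intros x Hx.
  apply (is_derive_eq_on r (d1 0%nat)); [easy|easy|].
  replace (d1 1%nat x) with (INR 1 * d1 1%nat x) by (simpl; ring).
  apply Hd1; [lia|easy].
Qed.

(** * Division by the coordinate *)

(** Normalised derivatives of g = f/x off 0: the Cauchy product of g with the jet (x, 1, 0, ...)
    reads d_(k+1) = x g_(k+1) + g_k, solved here for g_(k+1). *)
Fixpoint quot (d : nat -> R -> R) (k : nat) (x : R) : R :=
  match k with
  | O => d 0%nat x / x
  | S j => (d (S j) x - quot d j x) / x
  end.

(** At x = 0 the relation d_(k+1) = x g_(k+1) + g_k forces g_k(0) = d_(k+1)(0). *)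
Definition div_jet (d : nat -> R -> R) (k : nat) (x : R) : R :=
  if Req_EM_T x 0 then d (S k) 0 else quot d k x.

(* [quot_num d k x = x ^ (k+1) * quot d k x] has the simple derivative
   (k+1) x^k d_(k+1)(x), from which both the bounds and the behaviour at 0 follow. *)
Fixpoint quot_num (d : nat -> R -> R) (k : nat) (x : R) : R :=
  match k with
  | O => d 0%nat x
  | S j => x ^ S j * d (S j) x - quot_num d j x
  end.

Lemma quot_num_eq d k x : x <> 0 -> quot_num d k x = x ^ S k * quot d k x.
Proof.
intros Hx; induction k as [|k IH]; [simpl; field; easy|].
cbn [quot quot_num]; rewrite IH; simpl; field; easy.
Qed.

Lemma quot_num_0 d k : d 0%nat 0 = 0 -> quot_num d k 0 = 0.
Proof. intros H; induction k as [|k IH]; [easy|]; cbn [quot_num]; rewrite IH; simpl; ring. Qed.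

Lemma is_derive_pow_id n x : is_derive (fun y => y ^ S n) x (INR (S n) * x ^ n).
Proof.
pose proof (is_derive_pow (fun y => y) (S n) x 1 (is_derive_id (K := R_AbsRing) x)) as H.
simpl pred in H; now rewrite Rmult_1_r in H.
Qed.

Lemma quot_num_derive r K f d k x : jet r K f d -> (k < K)%nat -> Rabs x < r ->
  is_derive (quot_num d k) x (x ^ k * (INR (S k) * d (S k) x)).
Proof.
intros [_ Hd] Hk Hx; induction k as [|k IH].
- simpl pow; rewrite Rmult_1_l; apply (Hd 0%nat); easy.
- cbn [quot_num].
  replace (x ^ S k * (INR (S (S k)) * d (S (S k)) x)) with
    ((INR (S k) * x ^ k * d (S k) x + x ^ S k * (INR (S (S k)) * d (S (S k)) x)) -
     x ^ k * (INR (S k) * d (S k) x)) by ring.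
  apply (is_derive_minus (fun x => x ^ S k * d (S k) x) (quot_num d k)).
  + apply (Derive.is_derive_mult (fun y => y ^ S k)); [apply is_derive_pow_id|].
    apply Hd; easy.
  + apply IH; lia.
Qed.

(** The mean value theorem at a point c with Rabs c <= Rabs x. Integrating would give a further
    1/(k+1); [W_shift] absorbs that loss in [cm_divx]. *)
Lemma bound_of_derive_pow (phi F : R -> R) k x E :
  (forall s, Rabs s <= Rabs x -> is_derive phi s (s ^ k * F s)) ->
  (forall s, Rabs s <= Rabs x -> Rabs (F s) <= E) ->
  phi 0 = 0 -> Rabs (phi x) <= Rabs x ^ S k * E.
Proof.
intros Hd HF H0.
destruct (MVT_cor4 phi (fun s => s ^ k * F s) 0 (Rabs x)) with (b := x) as (c & Hc & Hcx).
- intros c Hc; apply Hd; now rewrite Rminus_0_r in Hc.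
- rewrite Rminus_0_r; lra.
- rewrite !Rminus_0_r in Hcx; rewrite H0, !Rminus_0_r in Hc.
  rewrite Hc, !Rabs_mult, <- RPow_abs.
  specialize (HF c Hcx).
  replace (Rabs x ^ S k * E) with (Rabs x ^ k * E * Rabs x) by (simpl; ring).
  apply Rmult_le_compat_r; [apply Rabs_pos|].
  apply Rmult_le_compat; try apply Rabs_pos; try easy.
  + apply pow_le, Rabs_pos.
  + apply pow_incr; split; [apply Rabs_pos|easy].
Qed.

Lemma quot_bound r K f d k x E : jet r K f d -> (k < K)%nat -> Rabs x < r ->
  f 0 = 0 -> x <> 0 ->
  (forall s, Rabs s < r -> Rabs (d (S k) s) <= E) ->
  Rabs (quot d k x) <= INR (S k) * E.
Proof.
intros Hj Hk Hx H0 Hx0 HE.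
assert (Hd0 : d 0%nat 0 = 0).
{ destruct Hj as [Hj _]; rewrite Hj; [easy|]; rewrite Rabs_R0.
  pose proof (Rabs_pos x); lra. }
pose proof (bound_of_derive_pow (quot_num d k) (fun s => INR (S k) * d (S k) s) k x
  (INR (S k) * E)) as H.
rewrite (quot_num_eq d k x Hx0), Rabs_mult, <- RPow_abs in H.
pose proof (Rabs_pos_lt x Hx0) as Hp.
apply Rmult_le_reg_l with (Rabs x ^ S k); [apply pow_lt; easy|].
apply H.
- intros s Hs; apply (quot_num_derive r K f); try easy; lra.
- intros s Hs; rewrite Rabs_mult, Rabs_pos_eq by apply pos_INR.
  apply Rmult_le_compat_l; [apply pos_INR|apply HE; lra].
- now apply quot_num_0.
Qed.

Lemma quot_derive r K f d k x : jet r K f d -> (k < K)%nat -> Rabs x < r -> x <> 0 ->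
  is_derive (quot d k) x (INR (S k) * quot d (S k) x).
Proof.
intros [_ Hd] Hk Hx Hx0; induction k as [|k IH].
- replace (INR 1 * quot d 1 x) with ((INR 1 * d 1%nat x * x - d 0%nat x * 1) / x ^ 2)
    by (simpl; field; easy).
  apply (is_derive_div (d 0%nat) (fun y => y)); [now apply Hd| |easy].
  apply (is_derive_id (K := R_AbsRing)).
- replace (INR (S (S k)) * quot d (S (S k)) x) with
    (((INR (S (S k)) * d (S (S k)) x - INR (S k) * quot d (S k) x) * x
      - (d (S k) x - quot d k x) * 1) / x ^ 2)
    by (cbn [quot]; rewrite (S_INR (S k)); field; easy).
  apply (is_derive_div (fun y => d (S k) y - quot d k y) (fun y => y)); [|apply (is_derive_id (K := R_AbsRing))|easy].
  apply (is_derive_minus (d (S k)) (quot d k)); [now apply Hd|apply IH; lia].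
Qed.

Lemma div_jet_derive_0 r K f d k : 0 < r -> jet r K f d -> (S k < K)%nat -> f 0 = 0 ->
  is_derive (div_jet d k) 0 (INR (S k) * d (S (S k)) 0).
Proof.
intros Hr Hj Hk H0.
assert (Hr0 : Rabs 0 < r) by (rewrite Rabs_R0; easy).
assert (Hd0 : d 0%nat 0 = 0) by (destruct Hj as [Hj _]; rewrite Hj; easy).
apply is_derive_Reals; intros eps Heps.
pose proof (INR_S_pos k) as HSk.
(* The final error is (k+1) * e1 = eps/2, strictly below eps. *)
set (e1 := eps / (2 * INR (S k))).
assert (He1 : 0 < e1) by (apply Rdiv_lt_0_compat; lra).
assert (Hd1 : derivable_pt_lim (d (S k)) 0 (INR (S (S k)) * d (S (S k)) 0)).
{ apply is_derive_Reals; apply Hj; [lia|easy]. }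
destruct (Hd1 e1 He1) as [del Hdel].
assert (Hm : 0 < Rmin del r) by (apply Rmin_pos; [apply cond_pos|easy]).
exists (mkposreal _ Hm); intros h Hh0 Hh; simpl in Hh.
pose proof (Rmin_l del r); pose proof (Rmin_r del r).
(* [psi] is [quot_num] minus its two leading Taylor terms; divided by h^(k+2) it is the error of the
   difference quotient at 0. Its derivative is s^k * F s, where F is k+1 times the first order error
   of [d (S k)]. *)
set (psi := fun s => quot_num d k s - s ^ S k * d (S k) 0
                     - s ^ S (S k) * (INR (S k) * d (S (S k)) 0)).
set (F := fun s => INR (S k) * (d (S k) s - d (S k) 0 - INR (S (S k)) * s * d (S (S k)) 0)).
assert (Hpsi : Rabs (psi h) <= Rabs h ^ S k * (INR (S k) * e1 * Rabs h)).
{ apply (bound_of_derive_pow psi F).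
  - intros s Hs; unfold psi, F.
    replace (s ^ k * (INR (S k) * (d (S k) s - d (S k) 0
               - INR (S (S k)) * s * d (S (S k)) 0)))
      with (s ^ k * (INR (S k) * d (S k) s) - INR (S k) * s ^ k * d (S k) 0
            - INR (S (S k)) * s ^ S k * (INR (S k) * d (S (S k)) 0)) by (simpl pow; ring).
    apply (is_derive_minus (fun s => quot_num d k s - s ^ S k * d (S k) 0)
             (fun s => s ^ S (S k) * (INR (S k) * d (S (S k)) 0))).
    + apply (is_derive_minus (quot_num d k) (fun s => s ^ S k * d (S k) 0)).
      * apply (quot_num_derive r K f); try easy; [lia|lra].
      * apply (is_derive_scal_l (fun s => s ^ S k) s (INR (S k) * s ^ k) (d (S k) 0)).
        apply is_derive_pow_id.
    + apply (is_derive_scal_l (fun s => s ^ S (S k)) s (INR (S (S k)) * s ^ S k)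
               (INR (S k) * d (S (S k)) 0)).
      apply is_derive_pow_id.
  - intros s Hs; unfold F; rewrite Rabs_mult, (Rabs_pos_eq (INR (S k))) by lra.
    rewrite (Rmult_assoc _ e1); apply Rmult_le_compat_l; [lra|].
    destruct (Req_dec s 0) as [->|Hs0].
    { replace (d (S k) 0 - d (S k) 0 - INR (S (S k)) * 0 * d (S (S k)) 0) with 0 by ring.
      rewrite Rabs_R0; pose proof (Rabs_pos h); nra. }
    specialize (Hdel s Hs0 ltac:(lra)); rewrite Rplus_0_l in Hdel.
    replace (d (S k) s - d (S k) 0 - INR (S (S k)) * s * d (S (S k)) 0) with
      (((d (S k) s - d (S k) 0) / s - INR (S (S k)) * d (S (S k)) 0) * s)
      by (field; easy).
    rewrite Rabs_mult; apply Rmult_le_compat; try apply Rabs_pos; lra.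
  - unfold psi; rewrite quot_num_0 by easy; simpl; ring. }
rewrite Rplus_0_l; unfold div_jet.
destruct (Req_EM_T 0 0) as [_|]; [|easy]; destruct (Req_EM_T h 0) as [|_]; [easy|].
unfold psi in Hpsi; rewrite quot_num_eq in Hpsi by easy.
replace (h ^ S k * quot d k h - h ^ S k * d (S k) 0 - h ^ S (S k) * (INR (S k) * d (S (S k)) 0))
  with (h ^ S k * (((quot d k h - d (S k) 0) / h - INR (S k) * d (S (S k)) 0) * h)) in Hpsi
  by (simpl; field; easy).
rewrite Rabs_mult, <- RPow_abs in Hpsi.
pose proof (Rabs_pos_lt h Hh0) as Hp.
apply Rmult_le_reg_l in Hpsi; [|apply pow_lt; easy].
rewrite Rabs_mult in Hpsi; apply Rmult_le_reg_r in Hpsi; [|easy].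
replace (INR (S k) * e1) with (eps / 2) in Hpsi by (unfold e1; field; lra).
lra.
Qed.

Lemma jet_div r K f d : 0 < r -> jet r (S K) f d -> f 0 = 0 ->
  jet r K (div_jet d 0) (div_jet d).
Proof.
intros Hr Hj H0; split; [easy|]; intros k x Hk Hx.
destruct (Req_dec x 0) as [->|Hx0].
- replace (div_jet d (S k) 0) with (d (S (S k)) 0)
    by (unfold div_jet; destruct (Req_EM_T 0 0); easy).
  apply (div_jet_derive_0 r (S K) f); try easy; lia.
- replace (div_jet d (S k) x) with (quot d (S k) x)
    by (unfold div_jet; destruct (Req_EM_T x 0); easy).
  apply (is_derive_ext_loc (quot d k)).
  + assert (Hp : 0 < Rabs x) by now apply Rabs_pos_lt.
    exists (mkposreal _ Hp); intros y Hy.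
    unfold div_jet; destruct (Req_EM_T y 0) as [->|]; [|easy].
    change (Rabs (0 - x) < Rabs x) in Hy.
    rewrite Rminus_0_l, Rabs_Ropp in Hy; lra.
  + apply (quot_derive r (S K) f); try easy; lia.
Qed.

Definition divx (f : R -> R) (x : R) : R := if Req_EM_T x 0 then Derive f 0 else f x / x.

Lemma divx_spec f x : f 0 = 0 -> f x = x * divx f x.
Proof.
intros H0; unfold divx; destruct (Req_EM_T x 0) as [->|Hx]; [now rewrite H0, Rmult_0_l|].
field; easy.
Qed.

Lemma divx_div_jet r K f d x : 0 < r -> jet r (S K) f d -> Rabs x < r ->
  div_jet d 0 x = divx f x.
Proof.
intros Hr [H0 Hd] Hx; unfold div_jet, divx; destruct (Req_EM_T x 0) as [Hx0|Hx0].
- symmetry; apply is_derive_unique, (is_derive_eq_on r (d 0%nat)); [easy|rewrite Rabs_R0; easy|].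
  replace (d 1%nat 0) with (INR 1 * d 1%nat 0) by (simpl; ring).
  apply Hd; [lia|rewrite Rabs_R0; easy].
- simpl; now rewrite H0.
Qed.

Lemma smooth_divx r f : 0 < r -> smooth r f -> f 0 = 0 -> smooth r (divx f).
Proof.
intros Hr Hf H0 K; destruct (Hf (S K)) as [d Hd].
exists (div_jet d); apply (jet_ext r K (div_jet d 0)).
- intros x Hx; now apply (divx_div_jet r K).
- now apply (jet_div r K f).
Qed.

Lemma cm_divx M r f : weight M -> 0 < r -> cm M r f -> f 0 = 0 -> cm M r (divx f).
Proof.
intros HM Hr (A & b & HA & Hb & H) H0.
destruct (W_shift M HM) as (B & HB & HW).
exists (A * b * B), (b * B); repeat split; [repeat apply Rmult_le_pos; lra|nra|].
intros K; destruct (H (S K)) as (d & Hd & Hbd).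
exists (div_jet d); split.
{ apply (jet_ext r K (div_jet d 0)).
  - intros x Hx; now apply (divx_div_jet r K).
  - now apply (jet_div r K f). }
intros k x Hk Hx.
assert (HE : forall s, Rabs s < r -> Rabs (d (S k) s) <= A * b ^ S k * W M (S k))
  by (intros s Hs; apply Hbd; [lia|easy]).
apply Rle_trans with (INR (S k) * (A * b ^ S k * W M (S k))).
- unfold div_jet; destruct (Req_EM_T x 0) as [Hx0|Hx0].
  + specialize (HE 0 ltac:(rewrite Rabs_R0; lra)).
    assert (1 <= INR (S k)) by (rewrite S_INR; pose proof (pos_INR k); lra).
    pose proof (Rabs_pos (d (S k) 0)); nra.
  + apply (quot_bound r (S K) f); try easy; lia.
- replace (INR (S k) * (A * b ^ S k * W M (S k))) with
    (A * b ^ S k * (INR (S k) * W M (S k))) by ring.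
  replace (A * b * B * (b * B) ^ k * W M k) with (A * b ^ S k * (B ^ S k * W M k))
    by (rewrite Rpow_mult_distr; simpl; ring).
  apply Rmult_le_compat_l; [|apply HW].
  apply Rmult_le_pos; [easy|apply pow_le; lra].
Qed.

Lemma smooth_continuous r f x : smooth r f -> Rabs x < r -> continuous f x.
Proof.
intros Hf Hx; destruct (Hf 1%nat) as (d & H0 & Hd).
apply (ex_derive_continuous (K := R_AbsRing) (V := R_NormedModule)).
exists (INR 1 * d 1%nat x); apply (is_derive_eq_on r (d 0%nat)); auto.
Qed.

Lemma continuous_R_eps (f : R -> R) x e : continuous f x -> 0 < e ->
  exists del, 0 < del /\ forall y, Rabs (y - x) < del -> Rabs (f y - f x) < e.
Proof.
intros Hc He.
destruct (Hc (fun z => Rabs (z - f x) < e)) as [del Hdel].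
{ exists (mkposreal e He); intros z Hz; exact Hz. }
exists del; split; [apply cond_pos|]; intros y Hy; apply Hdel; exact Hy.
Qed.

Lemma divx_unique r (f g : R -> R) : 0 < r -> continuous g 0 ->
  (forall x, Rabs x < r -> f x = x * g x) -> forall x, Rabs x < r -> divx f x = g x.
Proof.
intros Hr Hc H x Hx; unfold divx; destruct (Req_EM_T x 0) as [->|Hx0].
2: { rewrite H by easy; field; easy. }
apply is_derive_unique, is_derive_Reals; intros eps Heps.
destruct (continuous_R_eps g 0 eps Hc Heps) as (del & Hdel & Hg).
assert (Hm : 0 < Rmin del r) by (apply Rmin_pos; easy).
exists (mkposreal _ Hm); intros h Hh0 Hh; simpl in Hh.
pose proof (Rmin_l del r); pose proof (Rmin_r del r).
rewrite Rplus_0_l, (H h) by lra; rewrite (H 0) by (rewrite Rabs_R0; lra).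
replace ((h * g h - 0 * g 0) / h) with (g h) by (field; easy).
apply Hg; rewrite Rminus_0_r; lra.
Qed.

(** Continuity at 0 fixes the one value of [g] left open by f = x * g, so [g] is the quotient
    [divx f]. *)
Lemma cm_div_continuous M r (f g : R -> R) : weight M -> 0 < r -> cm M r f -> continuous g 0 ->
  (forall x, Rabs x < r -> f x = x * g x) -> cm M r g.
Proof.
intros HM Hr Hf Hc H.
apply (cm_ext M r (divx f)); [now apply divx_unique|].
apply cm_divx; try easy.
rewrite H by (rewrite Rabs_R0; easy); ring.
Qed.

(** * Flat functions and the Denjoy-Carleman theorem *)

Definition flat (f : R -> R) : Prop :=
  forall n, exists B r, 0 < r /\ forall t, t <> 0 -> Rabs t < r -> Rabs (f t) <= B * Rabs t ^ n.

Lemma flat_continuous_0 (f : R -> R) : continuous f 0 -> flat f -> f 0 = 0.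
Proof.
intros Hc Hf; destruct (Req_dec (f 0) 0) as [|Hn]; [easy|exfalso].
apply Rabs_pos_lt in Hn.
destruct (continuous_R_eps f 0 (Rabs (f 0) / 2) Hc ltac:(lra)) as (del & Hdel & Hg).
destruct (Hf 1%nat) as (B & r & Hr & HB).
set (c := Rabs (f 0)) in *.
set (t := Rmin (Rmin (del / 2) (r / 2)) (c / (4 * (Rabs B + 1)))).
pose proof (Rabs_pos B) as HB0.
assert (Hq : 0 < c / (4 * (Rabs B + 1))) by (apply Rdiv_lt_0_compat; lra).
assert (Ht : 0 < t) by (repeat apply Rmin_pos; lra).
assert (Ht1 : t <= del / 2) by (unfold t; eapply Rle_trans; [apply Rmin_l|apply Rmin_l]).
assert (Ht2 : t <= r / 2) by (unfold t; eapply Rle_trans; [apply Rmin_l|apply Rmin_r]).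
assert (Ht3 : t <= c / (4 * (Rabs B + 1))) by (apply Rmin_r).
assert (Hta : Rabs t = t) by (apply Rabs_pos_eq; lra).
specialize (HB t ltac:(lra) ltac:(lra)); specialize (Hg t).
rewrite Rminus_0_r in Hg; specialize (Hg ltac:(lra)).
rewrite Hta, pow_1 in HB.
assert (B * t <= c / 4).
{ apply Rle_trans with (Rabs B * t).
  - apply Rmult_le_compat_r; [lra|apply Rle_abs].
  - apply Rle_trans with ((Rabs B + 1) * (c / (4 * (Rabs B + 1)))); [apply Rmult_le_compat; lra|].
    right; field; lra. }
pose proof (Rabs_triang_inv (f 0) (f t)) as Hti.
rewrite Rabs_minus_sym in Hti; fold c in Hti; lra.
Qed.

(** Induction by division: f/x is flat again, and its k-th coefficient at 0 is the (k+1)-st of f. *)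
Lemma flat_jet_0 k : forall r K f d, 0 < r -> jet r K f d -> (k < K)%nat -> flat f ->
  d k 0 = 0.
Proof.
assert (Hf0 : forall r K f d, 0 < r -> jet r K f d -> (0 < K)%nat -> flat f -> f 0 = 0).
{ intros r K f d Hr [H0 Hd] HK Hf; apply flat_continuous_0; [|easy].
  apply (ex_derive_continuous (K := R_AbsRing) (V := R_NormedModule)).
  exists (INR 1 * d 1%nat 0); apply (is_derive_eq_on r (d 0%nat)); [easy| |].
  - rewrite Rabs_R0; easy.
  - apply Hd; [easy|rewrite Rabs_R0; easy]. }
induction k as [|k IH]; intros r K f d Hr Hj Hk Hf.
- pose proof Hj as [H0 _]; rewrite H0 by (rewrite Rabs_R0; easy).
  now apply (Hf0 r K f d).
- destruct K as [|K]; [lia|].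
  replace (d (S k) 0) with (div_jet d k 0)
    by (unfold div_jet; destruct (Req_EM_T 0 0); easy).
  assert (Hz : f 0 = 0) by (apply (Hf0 r (S K) f d); try easy; lia).
  apply (IH r K (div_jet d 0)); try lia; [easy|now apply (jet_div r K f)|].
  intros n; destruct (Hf (S n)) as (B & r1 & Hr1 & HB).
  exists B, (Rmin r r1); split; [apply Rmin_pos; easy|].
  intros t Ht0 Ht; pose proof (Rmin_l r r1); pose proof (Rmin_r r r1).
  rewrite (divx_div_jet r K f) by (easy || lra).
  apply Rmult_le_reg_l with (Rabs t); [now apply Rabs_pos_lt|].
  rewrite <- Rabs_mult, <- divx_spec by easy.
  eapply Rle_trans; [apply HB; [easy|lra]|]; simpl; right; ring.
Qed.

(* Bang's argument: moving by M_n / (4 b (n+1) M_(n+1)) at most doubles the ratio of the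
   jet to its a priori bound, and these step lengths have a divergent sum. *)
Lemma bang_step M r K f d A b n x0 x : weight M -> 0 <= A -> 0 < b ->
  jet r K f d -> (S n <= K)%nat ->
  (forall k y, (k <= K)%nat -> Rabs y < r -> Rabs (d k y) <= A * b ^ k * M k) ->
  Rabs x0 < r -> Rabs x < r ->
  (forall k, (k <= K)%nat -> Rabs (d k x0) <= A * b ^ k * M k * (2 ^ k / 2 ^ S n)) ->
  Rabs (x - x0) * (4 * b) <= M n / (INR (S n) * M (S n)) ->
  forall k, (k <= K)%nat -> Rabs (d k x) <= A * b ^ k * M k * (2 ^ k / 2 ^ n).
Proof.
intros HM HA Hb [_ Hd] HnK Hbd Hx0 Hx Hlev Hstep.
pose proof (weight_pos M HM) as Hp.
assert (H2 : forall i, 0 < 2 ^ i) by (intros; apply pow_lt; lra).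
assert (Hm : forall k, 0 <= A * b ^ k * M k).
{ intros k; pose proof (Hp k); pose proof (pow_lt b k Hb).
  repeat apply Rmult_le_pos; lra. }
(* For orders from n on, 2^k / 2^n >= 1 and the a priori bound suffices. *)
assert (Hbig : forall k y, (n <= k)%nat -> (k <= K)%nat -> Rabs y < r ->
  Rabs (d k y) <= A * b ^ k * M k * (2 ^ k / 2 ^ n)).
{ intros k y Hnk Hk Hy; eapply Rle_trans; [apply Hbd; easy|].
  rewrite <- (Rmult_1_r (A * b ^ k * M k)) at 1; apply Rmult_le_compat_l; [apply Hm|].
  apply Rmult_le_reg_r with (2 ^ n); [apply H2|].
  unfold Rdiv; rewrite Rmult_assoc, Rinv_l by (pose proof (H2 n); lra).
  rewrite Rmult_1_l, Rmult_1_r; apply Rle_pow; [lra|easy]. }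
assert (Hin : forall s, Rmin x0 x <= s <= Rmax x0 x ->
                Rabs s < r /\ Rabs (s - x0) <= Rabs (x - x0)).
{ intros s; apply Rabs_def2 in Hx0; apply Rabs_def2 in Hx.
  unfold Rmin, Rmax; destruct (Rle_dec x0 x) as [Hle|Hle]; intros Hs; split.
  - apply Rabs_def1; lra.
  - rewrite !Rabs_pos_eq; lra.
  - apply Rabs_def1; lra.
  - rewrite !Rabs_left1; lra. }
(* Downward in k = n - i, by the mean value theorem from x0. Half of the target is the bound at x0,
   the other half comes from order k+1. One step length serves all k <= n because (k+1) M(k+1)/M(k)
   increases with k. *)
assert (Hdown : forall i k s, (k + i = n)%nat -> Rmin x0 x <= s <= Rmax x0 x ->
  Rabs (d k s) <= A * b ^ k * M k * (2 ^ k / 2 ^ n)).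
{ induction i as [|i IH]; intros k s Hki Hs.
  { apply Hbig; [lia|lia|apply Hin, Hs]. }
  assert (Hk1 : forall c, Rmin x0 x <= c <= Rmax x0 x ->
     Rabs (d (S k) c) <= A * b ^ S k * M (S k) * (2 ^ S k / 2 ^ n)).
  { intros c Hc; apply IH; [lia|easy]. }
  clear IH.
  destruct (MVT_abs (d k) (fun y => INR (S k) * d (S k) y) x0 s) as (c & Hc & Hcs).
  { intros c Hc; apply is_derive_Reals, Hd; [lia|apply Hin].
    revert Hc Hs; unfold Rmin, Rmax.
    destruct (Rle_dec x0 s), (Rle_dec x0 x); lra. }
  assert (Hcx : Rmin x0 x <= c <= Rmax x0 x).
  { revert Hcs Hs; unfold Rmin, Rmax.
    destruct (Rle_dec x0 s), (Rle_dec x0 x); lra. }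
  specialize (Hk1 c Hcx); specialize (Hlev k ltac:(lia)).
  destruct (Hin s Hs) as [_ Hsx].
  rewrite Rabs_mult, (Rabs_pos_eq (INR (S k))) in Hc by apply pos_INR.
  assert (Hr : INR (S k) * M (S k) * (Rabs (x - x0) * (4 * b)) <= M k).
  { pose proof (Hp k); pose proof (Hp (S k)); pose proof (Hp n); pose proof (Hp (S n)).
    pose proof (weight_ratio_incr M HM (S i) k) as Hri.
    replace (k + S i)%nat with n in Hri by lia.
    pose proof (INR_S_pos k) as Hk0; pose proof (INR_S_pos n) as Hn0.
    assert (Hkn : INR (S k) <= INR (S n)) by (apply le_INR; lia).
    eapply Rle_trans.
    { apply Rmult_le_compat_l; [|exact Hstep]; apply Rmult_le_pos; lra. }
    apply Rmult_le_reg_r with (INR (S n) * M (S n)); [apply Rmult_lt_0_compat; lra|].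
    unfold Rdiv; rewrite <- !Rmult_assoc, (Rmult_assoc _ (/ _)).
    rewrite Rmult_assoc.
    replace (/ (INR (S n) * M (S n)) * INR (S n) * M (S n)) with 1 by (field; lra).
    rewrite Rmult_1_r.
    replace (M k * INR (S n) * M (S n)) with (INR (S n) * (M k * M (S n))) by ring.
    rewrite (Rmult_assoc (INR (S k))).
    apply Rmult_le_compat; try lra; apply Rmult_le_pos; lra. }
  apply Rle_trans with (Rabs (d k x0) + Rabs (d k s - d k x0)).
  { pose proof (Rabs_triang (d k x0) (d k s - d k x0)) as Ht.
    replace (d k x0 + (d k s - d k x0)) with (d k s) in Ht by ring; easy. }
  rewrite Hc.
  assert (Hq : 0 < 2 ^ k / 2 ^ n) by (apply Rdiv_lt_0_compat; apply H2).
  replace (2 ^ k / 2 ^ S n) with (2 ^ k / 2 ^ n / 2) in Hlev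
    by (simpl; field; pose proof (H2 n); lra).
  set (q := 2 ^ k / 2 ^ n) in *.
  replace (2 ^ S k / 2 ^ n) with (2 * q) in Hk1
    by (unfold q; simpl; field; pose proof (H2 n); lra).
  assert (Hlast : INR (S k) * Rabs (d (S k) c) * Rabs (s - x0) <= A * b ^ k * M k * (q / 2)).
  { apply Rle_trans with
      (INR (S k) * (A * b ^ S k * M (S k) * (2 * q)) * Rabs (x - x0)).
    - pose proof (INR_S_pos k).
      apply Rmult_le_compat; try apply Rabs_pos; try easy.
      + apply Rmult_le_pos; [lra|apply Rabs_pos].
      + apply Rmult_le_compat_l; lra.
    - replace (INR (S k) * (A * b ^ S k * M (S k) * (2 * q)) * Rabs (x - x0)) with
        (A * b ^ k * (q / 2) * (INR (S k) * M (S k) * (Rabs (x - x0) * (4 * b))))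
        by (simpl pow; field).
      replace (A * b ^ k * M k * (q / 2)) with (A * b ^ k * (q / 2) * M k) by ring.
      apply Rmult_le_compat_l; [|easy].
      pose proof (pow_lt b k Hb); apply Rmult_le_pos; [apply Rmult_le_pos|]; lra. }
  replace (A * b ^ k * M k * q) with
    (A * b ^ k * M k * (q / 2) + A * b ^ k * M k * (q / 2)) by field.
  apply Rplus_le_compat; easy. }
intros k Hk; destruct (Compare_dec.le_lt_dec n k) as [Hnk|Hnk].
- now apply Hbig.
- apply (Hdown (n - k)%nat); [lia|].
  split; [apply Rmin_r|apply Rmax_r].
Qed.

(** Unlike [sum_f_R0] it has an empty sum, so that [psum s K - psum s n] is the total of the steps
    n, ..., K-1. *)
Fixpoint psum (s : nat -> R) (n : nat) : R :=
  match n with O => 0 | S m => psum s m + s m end.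

Lemma psum_sum s n : psum s (S n) = sum_f_R0 s n.
Proof. induction n as [|n IH]; [simpl; ring|]; simpl in *; rewrite IH; reflexivity. Qed.

Lemma psum_mono s : (forall k, 0 <= s k) -> forall i n, psum s n <= psum s (n + i).
Proof.
intros Hs i n; induction i as [|i IH]; [rewrite Nat.add_0_r; lra|].
rewrite Nat.add_succ_r; simpl; pose proof (Hs (n + i)%nat); lra.
Qed.

(** With m_k = k! M_k the summand is m_k / m_(k+1): the ratio form of quasianalyticity. *)
Definition ratio_diverges (M : nat -> R) : Prop :=
  forall B, exists N, B < psum (fun k => M k / (INR (S k) * M (S k))) N.

(** A walk from 0 to x. The jet vanishes at 0, so level K holds there; each [bang_step] lowers the
    level by one, and the steps n to K-1 together cover the distance to x. *)
Lemma bang_chain M r K f d A b : weight M -> 0 <= A -> 0 < b -> jet r K f d ->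
  (forall k y, (k <= K)%nat -> Rabs y < r -> Rabs (d k y) <= A * b ^ k * M k) ->
  (forall k, (k <= K)%nat -> d k 0 = 0) ->
  forall j n x, (n + j = K)%nat -> Rabs x < r ->
  Rabs x * (4 * b) <= psum (fun k => M k / (INR (S k) * M (S k))) K
                      - psum (fun k => M k / (INR (S k) * M (S k))) n ->
  forall k, (k <= K)%nat -> Rabs (d k x) <= A * b ^ k * M k * (2 ^ k / 2 ^ n).
Proof.
intros HM HA Hb Hj Hbd Hz; pose proof (weight_pos M HM) as Hp.
set (s := fun k => M k / (INR (S k) * M (S k))).
assert (Hs : forall k, 0 < s k).
{ intros k; apply Rdiv_lt_0_compat; [apply Hp|].
  apply Rmult_lt_0_compat; [apply INR_S_pos|apply Hp]. }
pose proof (psum_mono s (fun k => Rlt_le _ _ (Hs k))) as Hmono.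
induction j as [|j IH]; intros n x Hn Hx Hle k Hk.
- replace n with K in * by lia.
  assert (x = 0).
  { pose proof (Rabs_pos x); destruct (Req_dec x 0) as [|Hne]; [easy|].
    apply Rabs_pos_lt in Hne; nra. }
  subst x; rewrite Hz, Rabs_R0 by easy.
  pose proof (Hp k); pose proof (pow_lt b k Hb).
  pose proof (Rdiv_lt_0_compat _ _ (pow_lt 2 k ltac:(lra)) (pow_lt 2 K ltac:(lra))).
  apply Rmult_le_pos; [apply Rmult_le_pos; [apply Rmult_le_pos|]|]; lra.
(* [x0] is [x] if the steps above n already reach it, otherwise the point on the segment from 0 to x
   where they are exactly used up; the rest is at most step n. *)
- assert (Hex : exists x0, Rabs x0 < r /\ Rabs x0 * (4 * b) <= psum s K - psum s (S n) /\
                  Rabs (x - x0) * (4 * b) <= s n).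
  { pose proof (Hmono j (S n)) as Hge; replace (S n + j)%nat with K in Hge by lia.
    simpl psum in Hge |- *.
    destruct (Rle_dec (Rabs x * (4 * b)) (psum s K - (psum s n + s n))) as [Hc|Hc].
    - exists x; split; [easy|]; split; [easy|].
      rewrite Rminus_diag, Rabs_R0; pose proof (Hs n); lra.
    - set (D := psum s K - (psum s n + s n)) in *.
      assert (HD : 0 <= D) by (unfold D; lra).
      assert (Hxp : 0 < Rabs x * (4 * b)) by lra.
      set (th := D / (Rabs x * (4 * b))).
      assert (Hth : th * (Rabs x * (4 * b)) = D) by (unfold th; field; split; nra).
      assert (Hth0 : 0 <= th) by (apply Rmult_le_pos; [easy|left; apply Rinv_0_lt_compat, Hxp]).
      assert (Hth1 : th <= 1) by nra.
      exists (th * x); rewrite Rabs_mult, (Rabs_pos_eq th) by easy.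
      split; [pose proof (Rabs_pos x); nra|]; split; [lra|].
      replace (x - th * x) with ((1 - th) * x) by ring.
      rewrite Rabs_mult, (Rabs_pos_eq (1 - th)) by lra.
      replace ((1 - th) * Rabs x * (4 * b)) with (Rabs x * (4 * b) - th * (Rabs x * (4 * b))) by ring.
      rewrite Hth; unfold D; lra. }
  destruct Hex as (x0 & Hx0 & Hx0l & Hxx0).
  apply (bang_step M r K f d A b n x0 x); try easy; try lia.
  intros k' Hk'; apply IH; try easy; lia.
Qed.

(** For each n, divergence supplies N such that the steps n to N-1 reach x; order 0 at level n then
    reads Rabs (f x) <= A / 2^n. *)
Theorem denjoy_carleman M r f : weight M -> ratio_diverges M -> 0 < r ->
  cm M r f -> flat f -> forall x, Rabs x < r -> f x = 0.
Proof.
intros HM Hdiv Hr (A & b & HA & Hb & Hcm) Hflat x Hx.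
set (s := fun k => M k / (INR (S k) * M (S k))).
assert (Hs : forall n, 0 <= s n).
{ intros n; pose proof (weight_pos M HM n); pose proof (weight_pos M HM (S n)).
  left; apply Rdiv_lt_0_compat; [easy|].
  apply Rmult_lt_0_compat; [apply INR_S_pos|easy]. }
pose proof (psum_mono s Hs) as Hmono.
assert (Hn : forall n, Rabs (f x) * 2 ^ n <= A).
{ intros n; destruct (Hdiv (Rabs x * (4 * b) + psum s n)) as (N & HN); fold s in HN.
  assert (HnN : (n <= N)%nat).
  { destruct (Compare_dec.le_lt_dec n N) as [|Hlt]; [easy|].
    pose proof (Hmono (n - N)%nat N) as Hm; replace (N + (n - N))%nat with n in Hm by lia.
    pose proof (Rabs_pos x); nra. }
  (* One order beyond N, since [flat_jet_0] covers orders strictly below that of the jet. *)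
  destruct (Hcm (S N)) as (d & Hd & Hbd).
  assert (Hd' : jet r N f d) by (apply (jet_le r r (S N)); [lra|lia|easy]).
  assert (H0 : Rabs (d 0%nat x) <= A * b ^ 0 * M 0%nat * (2 ^ 0 / 2 ^ n)).
  { apply (bang_chain M r N f d A b HM HA ltac:(lra) Hd') with (j := (N - n)%nat);
      try lia; try easy.
    - intros k y Hk Hy; eapply Rle_trans; [apply Hbd; [lia|easy]|].
      pose proof (pow_lt b k ltac:(lra)).
      apply Rmult_le_compat_l; [apply Rmult_le_pos; lra|now apply W_le].
    - intros k Hk; apply (flat_jet_0 k r (S N) f d); try easy; lia.
    - fold s; lra. }
  destruct Hd as [Hd0 _]; rewrite Hd0 in H0 by easy.
  rewrite (weight_0 M HM) in H0; simpl pow in H0.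
  pose proof (pow_lt 2 n ltac:(lra)).
  apply Rle_trans with (A * 1 * 1 * (1 / 2 ^ n) * 2 ^ n).
  - apply Rmult_le_compat_r; lra.
  - right; field; lra. }
destruct (Req_dec (f x) 0) as [|Hne]; [easy|exfalso].
apply Rabs_pos_lt in Hne.
destruct (Pow_x_infinity 2 ltac:(rewrite Rabs_pos_eq; lra) (A / Rabs (f x) + 1)) as (n & Hpow).
specialize (Hpow n (le_n n)); specialize (Hn n).
rewrite Rabs_pos_eq in Hpow by (apply pow_le; lra).
assert (Hq : A / Rabs (f x) * Rabs (f x) = A) by (field; lra).
nra.
Qed.

(** * Carleman's inequality: from the root form of quasianalyticity to the ratio form *)

Lemma ln_le_sub_1 x : 0 < x -> ln x <= x - 1.
Proof. intros Hx; pose proof (exp_ineq1_le (ln x)) as H; rewrite exp_ln in H by easy; lra. Qed.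

Lemma exp_le_mono x y : x <= y -> exp x <= exp y.
Proof. intros [H| ->]; [left; now apply exp_increasing|lra]. Qed.

(** The logarithm of (m/e)^m <= m! for m = i+1; the induction step is x (ln (x+1) - ln x) <= 1. *)
Lemma ln_fact_lower i :
  INR (S i) * ln (INR (S i)) - INR (S i) <= ln (INR (fact (S i))).
Proof.
induction i as [|i IH]; [simpl; rewrite ln_1; lra|].
change (fact (S (S i))) with (S (S i) * fact (S i))%nat.
rewrite mult_INR, ln_mult by (apply lt_0_INR; try apply lt_O_fact; lia).
pose proof (INR_S_pos i) as Hi; rewrite (S_INR (S i)).
set (x := INR (S i)) in *.
assert (Hl : ln (x + 1) - ln x <= / x).
{ rewrite <- ln_div by lra.
  eapply Rle_trans; [apply ln_le_sub_1, Rdiv_lt_0_compat; lra|].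
  right; field; lra. }
assert (x * (ln (x + 1) - ln x) <= 1).
{ apply Rle_trans with (x * / x); [apply Rmult_le_compat_l; lra|right; field; lra]. }
lra.
Qed.

(** The inequality of arithmetic and geometric means, from the tangent of ln at the arithmetic
    mean. *)
Lemma sum_ln_le (r : nat -> R) i : (forall j, 0 < r j) ->
  sum_f_R0 (fun j => ln (r j)) i <= INR (S i) * ln (sum_f_R0 r i / INR (S i)).
Proof.
intros Hr.
assert (Hp : 0 < sum_f_R0 r i).
{ induction i as [|i IH]; simpl; [apply Hr|]; pose proof (Hr (S i)); lra. }
pose proof (INR_S_pos i) as Hi.
set (m := sum_f_R0 r i / INR (S i)).
assert (Hm : 0 < m) by (apply Rdiv_lt_0_compat; easy).
apply Rle_trans with (sum_f_R0 (fun j => r j * / m + (ln m - 1)) i).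
- apply sum_Rle; intros j _.
  pose proof (ln_le_sub_1 (r j / m) ltac:(apply Rdiv_lt_0_compat; auto)) as H.
  rewrite ln_div in H by auto; unfold Rdiv in H; lra.
- rewrite sum_plus, sum_cte, <- scal_sum.
  right; unfold m at 1; field; split; lra.
Qed.

(** With m = i+1, 1/M(m) is the product of the m ratios M(j)/M(j+1), so its m-th root is at most
    their arithmetic mean. The bound m! >= (m/e)^m contributes e/m, and 3 bounds e. *)
Lemma rpower_fact_le M i : weight M ->
  Rpower (INR (fact (S i)) * M (S i)) (- / INR (S i)) <=
  3 * (sum_f_R0 (fun j => M j / M (S j)) i / INR (S i) ^ 2).
Proof.
intros HM; pose proof (weight_pos M HM) as Hp.
set (r := fun j => M j / M (S j)).
assert (Hr : forall j, 0 < r j) by (intros; apply Rdiv_lt_0_compat; apply Hp).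
assert (HlnM : forall i, ln (M (S i)) = - sum_f_R0 (fun j => ln (r j)) i).
{ induction i0 as [|i0 IH]; simpl; unfold r in *; rewrite ?IH in *.
  - rewrite ln_div, (weight_0 M HM), ln_1 by apply Hp; ring.
  - rewrite (ln_div (M (S i0))) by apply Hp; rewrite IH; ring. }
pose proof (sum_ln_le r i Hr) as Hs; pose proof (ln_fact_lower i) as Hf.
pose proof (INR_S_pos i) as Hi.
assert (HS : 0 < sum_f_R0 r i).
{ clear - Hr; induction i as [|i IH]; simpl; [apply Hr|]; pose proof (Hr (S i)); lra. }
assert (Hm : 0 < sum_f_R0 r i / INR (S i)) by (apply Rdiv_lt_0_compat; easy).
unfold Rpower; rewrite ln_mult by (try apply Hp; apply lt_0_INR, lt_O_fact).
rewrite HlnM.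
apply Rle_trans with (exp (1 + (ln (sum_f_R0 r i / INR (S i)) + - ln (INR (S i))))).
- apply exp_le_mono.
  apply Rmult_le_reg_l with (INR (S i)); [easy|].
  rewrite <- Rmult_assoc, Ropp_mult_distr_r_reverse, Rinv_r by lra.
  set (x := INR (S i)) in *; set (l := ln (sum_f_R0 r i / x)) in *; lra.
- rewrite exp_plus, exp_plus, exp_Ropp, !exp_ln by easy.
  replace (3 * (sum_f_R0 r i / INR (S i) ^ 2)) with
    (3 * (sum_f_R0 r i / INR (S i) * / INR (S i))) by (field; lra).
  apply Rmult_le_compat_r; [|apply exp_le_3].
  apply Rmult_le_pos; [lra|left; apply Rinv_0_lt_compat; easy].
Qed.

(* Carleman's inequality; the extra negative term makes the induction work. *)
Lemma sum_means_le (r : nat -> R) N : (forall j, 0 < r j) ->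
  sum_f_R0 (fun i => sum_f_R0 r i / INR (S i) ^ 2) N <=
  2 * sum_f_R0 (fun j => r j / INR (S j)) N - sum_f_R0 r N / INR (S N).
Proof.
intros Hr; induction N as [|N IH].
{ simpl; pose proof (Hr 0%nat); lra. }
rewrite !tech5.
assert (HS : 0 < sum_f_R0 r N).
{ clear - Hr; induction N as [|i IH]; simpl; [apply Hr|]; pose proof (Hr (S i)); lra. }
pose proof (Hr (S N)) as HrN.
rewrite (S_INR (S N)); pose proof (INR_S_pos N) as HN.
assert (1 <= INR (S N)) by (rewrite S_INR; pose proof (pos_INR N); lra).
set (x := INR (S N)) in *; set (S0 := sum_f_R0 r N) in *.
set (a := r (S N)) in *.
assert (H1 : (S0 + a) / (x + 1) ^ 2 <= 2 * (a / (x + 1)) + S0 / x - (S0 + a) / (x + 1)).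
{ apply Rmult_le_reg_r with (x * (x + 1) ^ 2); [nra|].
  replace ((S0 + a) / (x + 1) ^ 2 * (x * (x + 1) ^ 2)) with (x * (S0 + a)) by (field; lra).
  replace ((2 * (a / (x + 1)) + S0 / x - (S0 + a) / (x + 1)) * (x * (x + 1) ^ 2)) with
    (S0 * (x + 1) + a * x * (x + 1)) by (field; lra).
  nra. }
lra.
Qed.

Lemma quasianalytic_ratio_diverges M : weight M ->
  (forall B, exists N, B < sum_f_R0 (fun i =>
     Rpower (INR (fact (S i)) * M (S i)) (- / INR (S i))) N) ->
  ratio_diverges M.
Proof.
(* 6 is the 3 of [rpower_fact_le] times the 2 of [sum_means_le]. *)
intros HM Hq B; destruct (Hq (6 * B)) as [N HN]; exists (S N).
rewrite psum_sum.
pose proof (weight_pos M HM) as Hp.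
set (r := fun j => M j / M (S j)).
assert (Hr : forall j, 0 < r j) by (intros; apply Rdiv_lt_0_compat; apply Hp).
pose proof (sum_means_le r N Hr) as Hs.
assert (HS : 0 < sum_f_R0 r N / INR (S N)).
{ apply Rdiv_lt_0_compat; [|apply INR_S_pos].
  clear - Hr; induction N as [|i IH]; simpl; [apply Hr|]; pose proof (Hr (S i)); lra. }
assert (Hle : sum_f_R0 (fun i => Rpower (INR (fact (S i)) * M (S i)) (- / INR (S i))) N
  <= sum_f_R0 (fun i => sum_f_R0 r i / INR (S i) ^ 2 * 3) N).
{ apply sum_Rle; intros i _; rewrite (Rmult_comm _ 3); now apply rpower_fact_le. }
rewrite <- scal_sum in Hle.
rewrite (sum_eq (fun k => M k / (INR (S k) * M (S k))) (fun j => r j / INR (S j))).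
- lra.
- intros i _; unfold r; pose proof (Hp (S i)); pose proof (INR_S_pos i); field; lra.
Qed.

(** * Solutions of polynomial differential equations *)

(** The algebra over C^M generated by the unknowns [y j], which supplies the right-hand sides of
    polynomial differential systems. *)
Inductive alg (M : nat -> R) (r : R) (n : nat) (y : nat -> R -> R) : (R -> R) -> Prop :=
| alg_cm f : cm M r f -> alg M r n y f
| alg_var j : (j < n)%nat -> alg M r n y (y j)
| alg_plus f g : alg M r n y f -> alg M r n y g -> alg M r n y (fun x => f x + g x)
| alg_mult f g : alg M r n y f -> alg M r n y g -> alg M r n y (fun x => f x * g x).

(** [A] depends on the amplitude [a] of the unknowns but not on [b] or [K], so [b] may be enlarged
    later without moving the bound for the right-hand side. *)
Lemma alg_bound M r n y phi a : weight M -> 0 <= a -> alg M r n y phi ->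
  exists A b0, 0 <= A /\ 1 <= b0 /\ forall b K, b0 <= b ->
    (forall j, (j < n)%nat -> jet_bound M r K (y j) a b) -> jet_bound M r K phi A b.
Proof.
intros HM Ha; induction 1 as [f (A & b & HA & Hb & H)|j Hj|
  f g _ (A & b & HA & Hb & H) _ (A' & b' & HA' & Hb' & H')|
  f g _ (A & b & HA & Hb & H) _ (A' & b' & HA' & Hb' & H')].
- exists A, b; repeat split; try easy; intros b1 K Hb1 _.
  apply (jet_bound_mono M r K f A b); auto; lra.
- exists a, 1; repeat split; try lra; intros b K Hb H; now apply H.
- pose proof (Rmax_l b b'); pose proof (Rmax_r b b').
  exists (A + A'), (Rmax b b'); repeat split; try lra; intros b1 K Hb1 Hy.
  apply jet_bound_plus; [apply H|apply H']; try easy; lra.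
- pose proof (Rmax_l b b'); pose proof (Rmax_r b b').
  exists (8 * A * A'), (Rmax b b'); repeat split; try nra; intros b1 K Hb1 Hy.
  apply jet_bound_mult; try easy; [lra|apply H|apply H']; try easy; lra.
Qed.

Lemma uniform_bound (P : nat -> R -> Prop) n :
  (forall j, (j < n)%nat -> exists a, forall b, a <= b -> P j b) ->
  exists a, forall b j, a <= b -> (j < n)%nat -> P j b.
Proof.
induction n as [|n IH]; intros H; [exists 0; intros; lia|].
destruct IH as [a Ha]; [intros; apply H; lia|].
destruct (H n (Nat.lt_succ_diag_r n)) as [a' Ha'].
exists (Rmax a a'); intros b j Hb Hj.
pose proof (Rmax_l a a'); pose proof (Rmax_r a a').
destruct (Nat.eq_dec j n) as [->|Hne]; [apply Ha'; lra|apply Ha; [lra|lia]].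
Qed.

(** Integration raises the power of [b] by one, so the amplitude becomes 4A/b, with the 4 of
    [W_step]; this fits under [a]. *)
Lemma jet_bound_primitive M r K (f phi : R -> R) A a b : weight M -> 0 <= A -> 1 <= b ->
  4 * A <= a * b ->
  (forall x, Rabs x < r -> is_derive f x (phi x)) ->
  (forall x, Rabs x < r -> Rabs (f x) <= a) ->
  jet_bound M r K phi A b -> jet_bound M r (S K) f a b.
Proof.
intros HM HA Hb HAb Hder Hf (d & [Hd0 Hd] & Hbd).
exists (fun k x => match k with O => f x | S j => d j x / INR (S j) end); split; [split|].
- reflexivity.
- intros [|k] x Hk Hx.
  + replace (INR 1 * (d 0%nat x / INR 1)) with (phi x)
      by (rewrite Hd0 by easy; simpl; field).
    apply (Hder x Hx).
  + pose proof (INR_S_pos (S k)); pose proof (INR_S_pos k).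
    replace (INR (S (S k)) * (d (S k) x / INR (S (S k)))) with
      (/ INR (S k) * (INR (S k) * d (S k) x)) by (field; lra).
    apply (is_derive_ext (fun x => / INR (S k) * d k x)).
    { intros t; apply Rmult_comm. }
    apply (is_derive_scal (d k)), Hd; [lia|easy].
- intros [|k] x Hk Hx.
  + rewrite W_0 by easy; simpl pow; rewrite !Rmult_1_r; now apply Hf.
  + pose proof (INR_S_pos k).
    assert (1 <= INR (S k)) by (rewrite S_INR; pose proof (pos_INR k); lra).
    pose proof (Hbd k x ltac:(lia) Hx) as Hb'.
    pose proof (W_step M HM k) as Hw; pose proof (W_pos M HM (S k)).
    pose proof (pow_lt b k ltac:(lra)).
    unfold Rdiv; rewrite Rabs_mult, Rabs_inv, (Rabs_pos_eq (INR (S k))) by lra.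
    apply Rle_trans with (Rabs (d k x) * 1).
    { apply Rmult_le_compat_l; [apply Rabs_pos|].
      rewrite <- Rinv_1; apply Rinv_le_contravar; lra. }
    rewrite Rmult_1_r; eapply Rle_trans; [exact Hb'|].
    apply Rle_trans with (A * b ^ k * (4 * W M (S k))).
    { apply Rmult_le_compat_l; [apply Rmult_le_pos; lra|easy]. }
    replace (A * b ^ k * (4 * W M (S k))) with (4 * A * (b ^ k * W M (S k))) by ring.
    replace (a * b ^ S k * W M (S k)) with (a * b * (b ^ k * W M (S k))) by (simpl; ring).
    apply Rmult_le_compat_r; [apply Rmult_le_pos; lra|easy].
Qed.

(** Majorants by induction on the order: bounds (a1, b) for the unknowns up to order K give
    amplitude A for the right-hand sides, and one integration returns (a1, b) up to order K+1 once b
    is large against A. *)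
Theorem cm_ode M r n y a : weight M ->
  (forall j, (j < n)%nat -> exists phi, alg M r n y phi /\
     forall x, Rabs x < r -> is_derive (y j) x (phi x)) ->
  (forall j x, (j < n)%nat -> Rabs x < r -> Rabs (y j x) <= a) ->
  forall j, (j < n)%nat -> cm M r (y j).
Proof.
intros HM Hode Hbd.
set (a1 := Rmax 1 a); assert (Ha1 : 1 <= a1) by apply Rmax_l.
assert (Hbd1 : forall j x, (j < n)%nat -> Rabs x < r -> Rabs (y j x) <= a1).
{ intros j x Hj Hx; eapply Rle_trans; [now apply Hbd|apply Rmax_r]. }
destruct (uniform_bound (fun j b => 1 <= b -> forall K,
    (forall i, (i < n)%nat -> jet_bound M r K (y i) a1 b) ->
    jet_bound M r (S K) (y j) a1 b) n) as [b0 Hb0].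
{ intros j Hj; destruct (Hode j Hj) as (phi & Hphi & Hder).
  destruct (alg_bound M r n y phi a1 HM ltac:(lra) Hphi) as (A & b0 & HA & Hb0 & H).
  (* The requirement 4A <= a1 * b follows from 4A <= b because a1 >= 1. *)
  exists (Rmax b0 (4 * A)); intros b Hb Hb1 K HK.
  pose proof (Rmax_l b0 (4 * A)); pose proof (Rmax_r b0 (4 * A)).
  apply (jet_bound_primitive M r K (y j) phi A a1 b); try easy; try nra.
  - intros x Hx; now apply Hbd1.
  - apply H; [lra|easy]. }
set (b := Rmax 1 b0).
assert (Hb1 : 1 <= b) by apply Rmax_l; assert (Hb : b0 <= b) by apply Rmax_r.
intros j Hj; exists a1, b; repeat split; try lra.
intros K; revert j Hj; induction K as [|K IH]; intros j Hj.
- exists (fun _ => y j); split; [split; [easy|intros; lia]|].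
  intros k x Hk Hx; replace k with 0%nat by lia; rewrite W_0 by easy; simpl.
  rewrite !Rmult_1_r; now apply Hbd1.
- apply Hb0; try easy.
Qed.

(** * Complex-valued functions and polynomials over them *)

(** A common interface to [cm], [smooth] and [alg], so that closure of complex functions and
    polynomials is proved once. *)
Definition subalg (P : (R -> R) -> Prop) : Prop :=
  (forall c, P (fun _ => c)) /\
  (forall f g, P f -> P g -> P (fun x => f x + g x)) /\
  (forall f g, P f -> P g -> P (fun x => f x * g x)).

Lemma subalg_cm M r : weight M -> subalg (cm M r).
Proof.
intros HM; split; [|split]; intros; [now apply cm_const|now apply cm_plus|now apply cm_mult].
Qed.

Lemma subalg_smooth r : subalg (smooth r).
Proof.
split; [|split]; [|apply smooth_plus|apply smooth_mult].
intros c K; eexists; apply jet_const.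
Qed.

Lemma subalg_alg M r n y : weight M -> subalg (alg M r n y).
Proof.
intros HM; split; [|split]; [|apply alg_plus|apply alg_mult].
intros c; now apply alg_cm, cm_const.
Qed.

Lemma subalg_minus P f g : subalg P -> P f -> P g -> P (fun x => f x - g x).
Proof.
intros (Hc & Hp & Hm) Hf Hg.
replace (fun x => f x - g x) with (fun x => f x + (-1) * g x)
  by (apply functional_extensionality; intros; ring).
apply Hp; [easy|]; now apply Hm.
Qed.

Definition cpx (P : (R -> R) -> Prop) (f : R -> C) : Prop :=
  P (fun t => fst (f t)) /\ P (fun t => snd (f t)).

Lemma cpx_const P c : subalg P -> cpx P (fun _ => c).
Proof. intros (Hc & _); split; apply Hc. Qed.

Lemma cpx_plus P f g : subalg P -> cpx P f -> cpx P g -> cpx P (fun t => f t + g t)%C.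
Proof.
intros (_ & Hp & _) [Hf1 Hf2] [Hg1 Hg2]; split; [exact (Hp _ _ Hf1 Hg1)|exact (Hp _ _ Hf2 Hg2)].
Qed.

Lemma cpx_mult P f g : subalg P -> cpx P f -> cpx P g -> cpx P (fun t => f t * g t)%C.
Proof.
intros HP [Hf1 Hf2] [Hg1 Hg2]; pose proof HP as (_ & Hp & Hm); split.
- exact (subalg_minus _ _ _ HP (Hm _ _ Hf1 Hg1) (Hm _ _ Hf2 Hg2)).
- exact (Hp _ _ (Hm _ _ Hf1 Hg2) (Hm _ _ Hf2 Hg1)).
Qed.

Lemma cpx_imp (P Q : (R -> R) -> Prop) f : (forall g, P g -> Q g) -> cpx P f -> cpx Q f.
Proof. intros H [H1 H2]; split; auto. Qed.

(* Polynomials in one complex unknown whose coefficients are functions of t. *)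
Inductive zp : Type :=
| ZC : (R -> C) -> zp
| ZX : zp
| ZAdd : zp -> zp -> zp
| ZMul : zp -> zp -> zp.

Fixpoint ev (p : zp) (t : R) (z : C) : C :=
  match p with
  | ZC a => a t
  | ZX => z
  | ZAdd p q => (ev p t z + ev q t z)%C
  | ZMul p q => (ev p t z * ev q t z)%C
  end.

Fixpoint zpin (P : (R -> R) -> Prop) (p : zp) : Prop :=
  match p with
  | ZC a => cpx P a
  | ZX => True
  | ZAdd p q => zpin P p /\ zpin P q
  | ZMul p q => zpin P p /\ zpin P q
  end.

Fixpoint dz (p : zp) : zp :=
  match p with
  | ZC a => ZC (fun _ => 0%C)
  | ZX => ZC (fun _ => 1%C)
  | ZAdd p q => ZAdd (dz p) (dz q)
  | ZMul p q => ZAdd (ZMul (dz p) q) (ZMul p (dz q))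
  end.

Definition at_fun (p : zp) (h : R -> C) : R -> C := fun t => ev p t (h t).

Lemma cpx_at_fun P p h : subalg P -> zpin P p -> cpx P h -> cpx P (at_fun p h).
Proof.
intros HP Hp Hh; induction p as [a| |p IHp q IHq|p IHp q IHq]; unfold at_fun; simpl in *; try easy.
- apply cpx_plus; [easy|apply IHp|apply IHq]; apply Hp.
- apply cpx_mult; [easy|apply IHp|apply IHq]; apply Hp.
Qed.

Lemma zpin_dz P p : subalg P -> zpin P p -> zpin P (dz p).
Proof.
intros HP; induction p as [a| |p IHp q IHq|p IHp q IHq]; simpl; intros H.
- now apply cpx_const.
- now apply cpx_const.
- split; [apply IHp|apply IHq]; apply H.
- destruct H; repeat split; auto.
Qed.

Lemma zpin_imp (P Q : (R -> R) -> Prop) p : (forall g, P g -> Q g) -> zpin P p -> zpin Q p.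
Proof.
intros HPQ; induction p; simpl; try easy; [now apply cpx_imp|tauto|tauto].
Qed.

(* Second order Taylor remainder: see [ev_taylor]. *)
Fixpoint zrem (p : zp) (T s : R -> C) : zp :=
  match p with
  | ZC _ => ZC (fun _ => 0%C)
  | ZX => ZC (fun _ => 0%C)
  | ZAdd p q => ZAdd (zrem p T s) (zrem q T s)
  | ZMul p q =>
      let p0 := ZC (at_fun p T) in let p1 := ZC (at_fun (dz p) T) in
      let q0 := ZC (at_fun q T) in let q1 := ZC (at_fun (dz q) T) in
      let S := ZMul (ZC s) ZX in
      ZAdd (ZMul p1 q1)
        (ZAdd (ZMul (zrem p T s) (ZAdd q0 (ZAdd (ZMul S q1) (ZMul (ZMul S S) (zrem q T s)))))
              (ZMul (ZAdd p0 (ZMul S p1)) (zrem q T s)))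
  end.

(** An exact identity rather than an estimate: the remainder is again a polynomial in w, over any
    algebra containing T, s and the coefficients of p ([zpin_zrem]). *)
Lemma ev_taylor p T s t w :
  ev p t (T t + s t * w)%C =
  (ev p t (T t) + s t * w * ev (dz p) t (T t) + (s t * w) * (s t * w) * ev (zrem p T s) t w)%C.
Proof.
induction p as [a| |p IHp q IHq|p IHp q IHq]; simpl.
- ring.
- ring.
- rewrite IHp, IHq; ring.
- rewrite IHp, IHq; unfold at_fun; ring.
Qed.

Lemma zpin_zrem P p T s : subalg P -> zpin P p -> cpx P T -> cpx P s -> zpin P (zrem p T s).
Proof.
intros HP Hp HT Hs; induction p as [a| |p IHp q IHq|p IHp q IHq]; simpl in *.
- now apply cpx_const.
- now apply cpx_const.
- split; [apply IHp|apply IHq]; apply Hp.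
- destruct Hp as [Hp Hq].
  pose proof (cpx_at_fun P p T HP Hp HT); pose proof (cpx_at_fun P q T HP Hq HT).
  pose proof (cpx_at_fun P _ T HP (zpin_dz P p HP Hp) HT).
  pose proof (cpx_at_fun P _ T HP (zpin_dz P q HP Hq) HT).
  specialize (IHp Hp); specialize (IHq Hq); tauto.
Qed.

Lemma ev_bounded p t : exists B, forall w, Cmod w <= 1 -> Cmod (ev p t w) <= B.
Proof.
induction p as [a| |p [B HB] q [B' HB']|p [B HB] q [B' HB']]; simpl.
- exists (Cmod (a t)); intros; lra.
- exists 1; easy.
- exists (B + B'); intros w Hw; eapply Rle_trans; [apply Cmod_triangle|].
  specialize (HB w Hw); specialize (HB' w Hw); lra.
- exists (B * B'); intros w Hw; rewrite Cmod_mult.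
  apply Rmult_le_compat; try apply Cmod_ge_0; auto.
Qed.

(** [dz] acts on expressions, and distinct expressions may have equal values; this is what makes
    [dz] well defined on functions of z. Taylor's formula with a small real increment w bounds the
    derivative by w * B. *)
Lemma ev_dz_zero p t : (forall z, ev p t z = 0%C) -> forall z, ev (dz p) t z = 0%C.
Proof.
intros H z; destruct (ev_bounded (zrem p (fun _ => z) (fun _ => 1%C)) t) as [B HB].
apply Cmod_eq_0; apply Rle_antisym; [|apply Cmod_ge_0].
assert (HB0 : 0 <= B).
{ eapply Rle_trans; [apply Cmod_ge_0|apply (HB 0%C)]; rewrite Cmod_0; lra. }
apply le_epsilon; intros e He; rewrite Rplus_0_l.
set (w := Rmin 1 (e / (B + 1))).
assert (Hw : 0 < w) by (apply Rmin_pos; [lra|apply Rdiv_lt_0_compat; lra]).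
assert (Hw1 : w <= 1) by apply Rmin_l.
assert (Hw2 : w <= e / (B + 1)) by apply Rmin_r.
pose proof (ev_taylor p (fun _ => z) (fun _ => 1%C) t (RtoC w)) as HT.
rewrite !H in HT; cbn beta in HT.
specialize (HB (RtoC w)); rewrite Cmod_R, Rabs_pos_eq in HB by lra; specialize (HB Hw1).
set (rm := ev (zrem p (fun _ => z) (fun _ => 1%C)) t (RtoC w)) in *.
assert (Hw0 : RtoC w <> 0%C) by (intros E; apply RtoC_inj in E; lra).
assert (Hd : ev (dz p) t z = (- RtoC w * rm)%C).
{ replace (ev (dz p) t z) with ((1 * RtoC w * ev (dz p) t z) / RtoC w)%C by (field; easy).
  replace (1 * RtoC w * ev (dz p) t z)%C with
    ((0 + 1 * RtoC w * ev (dz p) t z + 1 * RtoC w * (1 * RtoC w) * rm)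
      - 1 * RtoC w * (1 * RtoC w) * rm)%C by ring.
  rewrite <- HT; field; easy. }
rewrite Hd, Cmod_mult, Cmod_opp, Cmod_R, Rabs_pos_eq by lra.
apply Rle_trans with (e / (B + 1) * B).
- apply Rmult_le_compat; try lra; apply Cmod_ge_0.
- apply Rle_trans with (e / (B + 1) * (B + 1)); [|right; field; lra].
  apply Rmult_le_compat_l; lra.
Qed.

Lemma ev_dz_ext p q t : (forall z, ev p t z = ev q t z) ->
  forall z, ev (dz p) t z = ev (dz q) t z.
Proof.
intros H z.
pose proof (ev_dz_zero (ZAdd p (ZMul (ZC (fun _ => (-1)%C)) q)) t) as H0; simpl in H0.
assert (E : forall z, (ev p t z + -1 * ev q t z)%C = 0%C) by (intros; rewrite H; ring).
specialize (H0 E z).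
replace (ev (dz p) t z) with
  (ev (dz p) t z + (0 * ev q t z + -1 * ev (dz q) t z) + ev (dz q) t z)%C by ring.
rewrite H0; ring.
Qed.

Fixpoint dzn (e : nat) (p : zp) : zp :=
  match e with O => p | S e => dzn e (dz p) end.

Lemma dz_dzn e p : dz (dzn e p) = dzn (S e) p.
Proof. revert p; induction e as [|e IH]; intros p; [easy|]; apply (IH (dz p)). Qed.

Lemma zpin_dzn P e p : subalg P -> zpin P p -> zpin P (dzn e p).
Proof.
intros HP; revert p; induction e as [|e IH]; intros p Hp; [easy|]; now apply IH, zpin_dz.
Qed.

Fixpoint zpow (p : zp) (e : nat) : zp :=
  match e with O => ZC (fun _ => 1%C) | S e => ZMul p (zpow p e) end.

Lemma ev_zpow p e t z : ev (zpow p e) t z = (ev p t z ^ e)%C.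
Proof. induction e as [|e IH]; simpl; [easy|now rewrite IH]. Qed.

Lemma ev_dz_zpow_linear a e t z :
  ev (dz (zpow (ZAdd ZX (ZC (fun _ => a))) (S e))) t z = (RtoC (INR (S e)) * (z + a) ^ e)%C.
Proof.
induction e as [|e IH]; [simpl; ring|].
change (dz (zpow (ZAdd ZX (ZC (fun _ => a))) (S (S e)))) with
  (ZAdd (ZMul (ZAdd (ZC (fun _ => 1%C)) (ZC (fun _ => 0%C))) (zpow (ZAdd ZX (ZC (fun _ => a))) (S e)))
     (ZMul (ZAdd ZX (ZC (fun _ => a))) (dz (zpow (ZAdd ZX (ZC (fun _ => a))) (S e))))).
cbn [ev]; rewrite ev_zpow; cbn [ev].
rewrite IH, (S_INR (S e)), RtoC_plus; simpl Cpow; ring.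
Qed.

Lemma ev_dzn_multiple_root : forall e p q t a,
  (forall z, ev p t z = (z + - a) ^ S e * ev q t z)%C ->
  ev (dzn e p) t a = 0%C /\
  ev (dzn (S e) p) t a = (RtoC (INR (fact (S e))) * ev q t a)%C.
Proof.
assert (Hd : forall e p q t a, (forall z, ev p t z = (z + - a) ^ S e * ev q t z)%C ->
  forall z, ev (dz p) t z = ((z + - a) ^ e * (RtoC (INR (S e)) * ev q t z
                              + (z + - a) * ev (dz q) t z))%C).
{ intros e p q t a H z.
  rewrite (ev_dz_ext p (ZMul (zpow (ZAdd ZX (ZC (fun _ => (- a)%C))) (S e)) q)).
  - change (ev (dz (ZMul ?p ?q)) t z) with (ev (dz p) t z * ev q t z + ev p t z * ev (dz q) t z)%C.
    rewrite ev_dz_zpow_linear, ev_zpow; simpl; ring.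
  - intros w; rewrite H; cbn [ev]; rewrite ev_zpow; reflexivity. }
induction e as [|e IH]; intros p q t a H.
- split; [simpl; rewrite H; simpl; ring|].
  cbn [dzn]; rewrite (Hd 0%nat p q t a H a); simpl; ring.
(* One derivative lowers the exponent by one and turns the cofactor q into (e+2) q + (z - a) dq/dz,
   whose value (e+2) q(a) at a builds up the factorial. *)
- destruct (IH (dz p) (ZAdd (ZMul (ZC (fun _ => RtoC (INR (S (S e))))) q)
      (ZMul (ZAdd ZX (ZC (fun _ => (- a)%C))) (dz q))) t a) as [H1 H2].
  { intros z; rewrite (Hd (S e) p q t a H z); reflexivity. }
  split; [exact H1|].
  change (dzn (S (S e)) p) with (dzn (S e) (dz p)); rewrite H2; cbn [ev].
  change (fact (S (S e))) with (S (S e) * fact (S e))%nat; rewrite mult_INR, RtoC_mult.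
  ring.
Qed.

(** * Differentiation along complex curves and the implicit equation *)

Definition cderiv (h : R -> C) (t : R) (l : C) : Prop :=
  is_derive (fun s => fst (h s)) t (fst l) /\ is_derive (fun s => snd (h s)) t (snd l).

Lemma cderiv_plus f g t l m : cderiv f t l -> cderiv g t m ->
  cderiv (fun s => f s + g s)%C t (l + m)%C.
Proof.
intros [H1 H2] [H3 H4]; split.
- exact (is_derive_plus _ _ _ _ _ H1 H3).
- exact (is_derive_plus _ _ _ _ _ H2 H4).
Qed.

Lemma cderiv_mult f g t l m : cderiv f t l -> cderiv g t m ->
  cderiv (fun s => f s * g s)%C t (l * g t + f t * m)%C.
Proof.
intros [H1 H2] [H3 H4]; split.
- replace (fst (l * g t + f t * m)%C) with
    ((fst l * fst (g t) + fst (f t) * fst m) - (snd l * snd (g t) + snd (f t) * snd m))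
    by (simpl; ring).
  exact (is_derive_minus _ _ _ _ _ (Derive.is_derive_mult _ _ _ _ _ H1 H3)
           (Derive.is_derive_mult _ _ _ _ _ H2 H4)).
- replace (snd (l * g t + f t * m)%C) with
    ((fst l * snd (g t) + fst (f t) * snd m) + (snd l * fst (g t) + snd (f t) * fst m))
    by (simpl; ring).
  exact (is_derive_plus _ _ _ _ _ (Derive.is_derive_mult _ _ _ _ _ H1 H4)
           (Derive.is_derive_mult _ _ _ _ _ H2 H3)).
Qed.

(** [q] is [p] with its coefficients differentiated in t; it is the same for all curves h. *)
Lemma ev_chain M r p : weight M -> zpin (cm M r) p ->
  exists q, zpin (cm M r) q /\ forall h t l, Rabs t < r -> cderiv h t l ->
    cderiv (at_fun p h) t (ev q t (h t) + ev (dz p) t (h t) * l)%C.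
Proof.
intros HM; pose proof (subalg_cm M r HM) as HA.
induction p as [a| |p IHp q IHq|p IHp q IHq]; simpl; intros H.
- destruct H as [H1 H2].
  destruct (cm_derive M r _ HM H1) as (a1 & Ha1 & Hd1).
  destruct (cm_derive M r _ HM H2) as (a2 & Ha2 & Hd2).
  exists (ZC (fun t => (a1 t, a2 t))); split; [split; assumption|].
  intros h t l Ht _; simpl.
  assert (E : forall u : C, (u + 0 * l)%C = u) by (intros; ring); rewrite E.
  split; [exact (Hd1 t Ht)|exact (Hd2 t Ht)].
- exists (ZC (fun _ => 0%C)); split; [now apply cpx_const|].
  intros h t l _ Hl; simpl; replace (0 + 1 * l)%C with l by ring; exact Hl.
- destruct (IHp (proj1 H)) as (p' & Hp' & Hdp); destruct (IHq (proj2 H)) as (q' & Hq' & Hdq).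
  exists (ZAdd p' q'); split; [easy|]; intros h t l Ht Hl; simpl.
  replace (ev p' t (h t) + ev q' t (h t) + (ev (dz p) t (h t) + ev (dz q) t (h t)) * l)%C with
    ((ev p' t (h t) + ev (dz p) t (h t) * l) + (ev q' t (h t) + ev (dz q) t (h t) * l))%C by ring.
  exact (cderiv_plus _ _ _ _ _ (Hdp h t l Ht Hl) (Hdq h t l Ht Hl)).
- destruct H as [Hp Hq].
  destruct (IHp Hp) as (p' & Hp' & Hdp); destruct (IHq Hq) as (q' & Hq' & Hdq).
  exists (ZAdd (ZMul p' q) (ZMul p q')); split; [easy|]; intros h t l Ht Hl; simpl.
  pose proof (cderiv_mult _ _ _ _ _ (Hdp h t l Ht Hl) (Hdq h t l Ht Hl)) as H.
  refine (eq_ind _ (cderiv _ t) H _ _); unfold at_fun; ring.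
Qed.

Lemma cderiv_unique h t l m : cderiv h t l -> cderiv h t m -> l = m.
Proof.
intros [H1 H2] [H3 H4].
apply is_derive_unique in H1; apply is_derive_unique in H2.
apply is_derive_unique in H3; apply is_derive_unique in H4.
destruct l, m; simpl in *; congruence.
Qed.

Lemma is_derive_continuous_eps (f : R -> R) x l e : is_derive f x l -> 0 < e ->
  exists del, 0 < del /\ forall y, Rabs (y - x) < del -> Rabs (f y - f x) < e.
Proof.
intros H; apply continuous_R_eps.
apply (ex_derive_continuous (K := R_AbsRing) (V := R_NormedModule)); now exists l.
Qed.

Lemma subalg_opp P f : subalg P -> P f -> P (fun x => - f x).
Proof.
intros HP Hf.
replace (fun x => - f x) with (fun x => 0 - f x)
  by (apply functional_extensionality; intros; ring).
apply (subalg_minus P (fun _ => 0) f); try easy; apply HP.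
Qed.

Lemma cderiv_zero r (h : R -> C) t l : (forall s, Rabs s < r -> h s = 0%C) -> Rabs t < r ->
  cderiv h t l -> l = 0%C.
Proof.
intros H Ht Hl; apply (cderiv_unique h t); [easy|]; split.
- apply (is_derive_eq_on r (fun _ => 0)); [intros y Hy; now rewrite H|easy|].
  apply (is_derive_const (V := R_NormedModule)).
- apply (is_derive_eq_on r (fun _ => 0)); [intros y Hy; now rewrite H|easy|].
  apply (is_derive_const (V := R_NormedModule)).
Qed.

(* The solution h and the inverse of |dG/dz|^2 along h satisfy a polynomial
   differential system over C^M. *)
Theorem cm_implicit M r G h h' : weight M -> 0 < r -> zpin (cm M r) G ->
  (forall t, Rabs t < r -> cderiv h t (h' t)) ->
  (forall t, Rabs t < r -> ev G t (h t) = 0%C) ->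
  ev (dz G) 0 (h 0) <> 0%C ->
  exists r', 0 < r' <= r /\ cpx (cm M r') h.
Proof.
intros HM Hr HG Hh HG0 Hne.
pose proof (subalg_cm M r HM) as HAr.
destruct (ev_chain M r G HM HG) as (Gt & HGt & HdG).
destruct (ev_chain M r (dz G) HM (zpin_dz _ _ HAr HG)) as (Wt & HWt & HdW).
set (w := at_fun (dz G) h).
set (nrm := fun t => fst (w t) * fst (w t) + snd (w t) * snd (w t)).
set (w' := fun t => (ev Wt t (h t) + ev (dz (dz G)) t (h t) * h' t)%C).
assert (Hw : forall t, Rabs t < r -> cderiv w t (w' t)).
{ intros t Ht; apply HdW; auto. }
set (nrm' := fun t => 2 * (fst (w t) * fst (w' t) + snd (w t) * snd (w' t))).
assert (Hnrm : forall t, Rabs t < r -> is_derive nrm t (nrm' t)).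
{ intros t Ht; destruct (Hw t Ht) as [H1 H2].
  replace (nrm' t) with ((fst (w' t) * fst (w t) + fst (w t) * fst (w' t)) +
     (snd (w' t) * snd (w t) + snd (w t) * snd (w' t))) by (unfold nrm'; ring).
  exact (is_derive_plus _ _ _ _ _ (Derive.is_derive_mult _ _ _ _ _ H1 H1)
           (Derive.is_derive_mult _ _ _ _ _ H2 H2)). }
assert (H00 : Rabs 0 < r) by (rewrite Rabs_R0; easy).
assert (Hn0 : 0 < nrm 0).
{ unfold nrm; fold (at_fun (dz G) h 0) in Hne; fold w in Hne.
  destruct (Req_dec (fst (w 0)) 0) as [E1|E1]; [|nra].
  destruct (Req_dec (snd (w 0)) 0) as [E2|E2]; [|nra].
  exfalso; apply Hne; apply injective_projections; easy. }
(* Near 0 continuity keeps |dG/dz|^2 above half its value at 0 and h bounded, as the a priori bounds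
   of [cm_ode] require. *)
destruct (is_derive_continuous_eps nrm 0 _ (nrm 0 / 2) (Hnrm 0 H00) ltac:(lra))
  as (d1 & Hd1 & Hc1).
destruct (Hh 0 H00) as [Hh1 Hh2].
destruct (is_derive_continuous_eps _ 0 _ 1 Hh1 ltac:(lra)) as (d2 & Hd2 & Hc2).
destruct (is_derive_continuous_eps _ 0 _ 1 Hh2 ltac:(lra)) as (d3 & Hd3 & Hc3).
set (r' := Rmin (Rmin r d1) (Rmin d2 d3)).
assert (Hr' : 0 < r') by (repeat apply Rmin_pos; easy).
assert (Hb : r' <= r /\ r' <= d1 /\ r' <= d2 /\ r' <= d3).
{ unfold r'; pose proof (Rmin_l (Rmin r d1) (Rmin d2 d3)).
  pose proof (Rmin_r (Rmin r d1) (Rmin d2 d3)).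
  pose proof (Rmin_l r d1); pose proof (Rmin_r r d1).
  pose proof (Rmin_l d2 d3); pose proof (Rmin_r d2 d3); lra. }
destruct Hb as (Hb0 & Hb1 & Hb2 & Hb3).
assert (Hnp : forall t, Rabs t < r' -> nrm 0 / 2 < nrm t).
{ intros t Ht; specialize (Hc1 t); rewrite Rminus_0_r in Hc1.
  specialize (Hc1 ltac:(lra)); apply Rabs_def2 in Hc1; lra. }
set (y := fun j : nat => match j with
  | O => fun t => fst (h t) | S O => fun t => snd (h t) | _ => fun t => / nrm t end).
set (AL := alg M r' 3 y).
assert (HA : subalg AL) by now apply subalg_alg.
assert (Hha : cpx AL h).
{ split; [apply (alg_var M r' 3 y 0)|apply (alg_var M r' 3 y 1)]; lia. }
assert (Hna : AL (fun t => / nrm t)) by (apply (alg_var M r' 3 y 2); lia).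
assert (Hin : forall p, zpin (cm M r) p -> cpx AL (at_fun p h)).
{ intros p Hp; apply cpx_at_fun; try easy.
  apply (zpin_imp (cm M r)); [|easy].
  intros v Hv; apply alg_cm, (cm_le M r); [lra|exact Hv]. }
assert (Hwa : cpx AL w) by exact (Hin _ (zpin_dz _ _ HAr HG)).
set (cw := fun t => (fst (w t), - snd (w t)) : C).
assert (Hcwa : cpx AL cw).
{ split; [apply Hwa|]; apply (subalg_opp AL (fun t => snd (w t))); [easy|apply Hwa]. }
(* This is h' = - (dG/dt) / (dG/dz), with 1/w written as the conjugate of w times 1/|w|^2, hence
   polynomial in the three unknowns. *)
set (hp := fun t => (cw t * RtoC (/ nrm t)%R * (-1 * at_fun Gt h t))%C).
assert (Hhpa : cpx AL hp).
{ apply cpx_mult; [easy| |].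
  - apply cpx_mult; [easy|easy|].
    exact (conj Hna (proj1 HA 0)).
  - apply cpx_mult; [easy|now apply cpx_const|now apply Hin]. }
assert (Hhp : forall t, Rabs t < r' -> h' t = hp t).
{ intros t Ht; assert (Htr : Rabs t < r) by lra.
  pose proof (cderiv_zero r (at_fun G h) t _ HG0 Htr (HdG h t (h' t) Htr (Hh t Htr))) as H0.
  unfold hp; replace (-1 * at_fun Gt h t)%C with (w t * h' t)%C.
  - replace (cw t * RtoC (/ nrm t)%R * (w t * h' t))%C with
      ((cw t * RtoC (/ nrm t)%R * w t) * h' t)%C by ring.
    replace (cw t * RtoC (/ nrm t)%R * w t)%C with (RtoC 1); [ring|].
    pose proof (Hnp t Ht); unfold nrm in *.
    apply injective_projections; simpl; field; lra.
  - unfold at_fun at 1; fold (at_fun (dz G) h t) in H0; fold w in H0.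
    replace (w t * h' t)%C with (ev Gt t (h t) + w t * h' t + -1 * ev Gt t (h t))%C by ring.
    rewrite H0; ring. }
set (wp := fun t => (at_fun Wt h t + at_fun (dz (dz G)) h t * hp t)%C).
assert (Hwpa : cpx AL wp).
{ apply cpx_plus; [easy|now apply Hin|]; apply cpx_mult; [easy| |easy].
  apply Hin, zpin_dz, zpin_dz; easy. }
assert (Hwp : forall t, Rabs t < r' -> w' t = wp t).
{ intros t Ht; unfold w', wp; rewrite Hhp by easy; reflexivity. }
assert (Hy : forall j, (j < 3)%nat -> cm M r' (y j)).
{ apply (cm_ode M r' 3 y (Rmax (2 / nrm 0) (Rmax (1 + Rabs (fst (h 0))) (1 + Rabs (snd (h 0)))))); [easy| |].
  - intros [|[|[|j]]] Hj; [| | |lia]; unfold y.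
    + exists (fun t => fst (hp t)); split; [apply Hhpa|].
      intros t Ht; rewrite <- Hhp by easy; apply Hh; lra.
    + exists (fun t => snd (hp t)); split; [apply Hhpa|].
      intros t Ht; rewrite <- Hhp by easy; apply Hh; lra.
    + exists (fun t => (-2) * (/ nrm t * / nrm t) *
                (fst (w t) * fst (wp t) + snd (w t) * snd (wp t))); split.
      * destruct HA as (HAc & HAp & HAm), Hwa as [Hw1 Hw2], Hwpa as [Hw3 Hw4].
        apply (HAm (fun t => (-2) * (/ nrm t * / nrm t))
                 (fun t => fst (w t) * fst (wp t) + snd (w t) * snd (wp t))).
        -- exact (HAm _ _ (HAc (-2)) (HAm _ _ Hna Hna)).
        -- exact (HAp _ _ (HAm _ _ Hw1 Hw3) (HAm _ _ Hw2 Hw4)).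
      * intros t Ht; pose proof (Hnp t Ht).
        replace (-2 * (/ nrm t * / nrm t) *
                (fst (w t) * fst (wp t) + snd (w t) * snd (wp t))) with (- nrm' t / nrm t ^ 2)
          by (unfold nrm'; rewrite Hwp by easy; field; lra).
        apply is_derive_inv; [apply Hnrm; lra|lra].
  - set (m1 := 2 / nrm 0); set (m2 := 1 + Rabs (fst (h 0))); set (m3 := 1 + Rabs (snd (h 0))).
    pose proof (Rmax_l m1 (Rmax m2 m3)); pose proof (Rmax_r m1 (Rmax m2 m3)).
    pose proof (Rmax_l m2 m3); pose proof (Rmax_r m2 m3).
    intros [|[|[|j]]] t Hj Ht; [| | |lia]; unfold y.
    + specialize (Hc2 t); rewrite Rminus_0_r in Hc2; specialize (Hc2 ltac:(lra)).
      pose proof (Rabs_triang_inv (fst (h t)) (fst (h 0))).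
      apply Rle_trans with m2; [unfold m2; lra|lra].
    + specialize (Hc3 t); rewrite Rminus_0_r in Hc3; specialize (Hc3 ltac:(lra)).
      pose proof (Rabs_triang_inv (snd (h t)) (snd (h 0))).
      apply Rle_trans with m3; [unfold m3; lra|lra].
    + pose proof (Hnp t Ht); rewrite Rabs_pos_eq by (left; apply Rinv_0_lt_compat; lra).
      apply Rle_trans with m1; [|lra]; unfold m1.
      replace (2 / nrm 0) with (/ (nrm 0 / 2)) by (field; lra).
      apply Rinv_le_contravar; lra. }
exists r'; split; [lra|]; split; [apply (Hy 0%nat)|apply (Hy 1%nat)]; lia.
Qed.

(** * Division by t, Taylor expansion and boundedness of complex functions *)

Lemma cpx_ext_cm M r f g : (forall t, Rabs t < r -> f t = g t) ->
  cpx (cm M r) f -> cpx (cm M r) g.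
Proof.
intros E [H1 H2]; split; [apply (cm_ext M r (fun t => fst (f t)))|apply (cm_ext M r (fun t => snd (f t)))];
  try easy; intros x Hx; now rewrite E.
Qed.

Lemma cpx_RtoC P n : subalg P -> P (fun t => t) -> cpx P (fun t => RtoC t ^ n)%C.
Proof.
intros HP Hid; induction n as [|n IH]; [exact (cpx_const P (RtoC 1) HP)|].
apply (cpx_mult P (fun t => RtoC t) (fun t => RtoC t ^ n)%C); [easy| |easy].
exact (conj Hid (proj1 HP 0)).
Qed.

Lemma smooth_id r : smooth r (fun t => t).
Proof. intros K; eexists; apply jet_id. Qed.

Lemma Cmod_le_sum z : Cmod z <= Rabs (fst z) + Rabs (snd z).
Proof.
replace z with (RtoC (fst z) + Ci * RtoC (snd z))%C at 1
  by (apply injective_projections; simpl; ring).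
eapply Rle_trans; [apply Cmod_triangle|].
rewrite Cmod_mult, Cmod_Ci, !Cmod_R; lra.
Qed.

Lemma csmooth_near_0 r f e : 0 < r -> cpx (smooth r) f -> 0 < e ->
  exists del, 0 < del <= r /\ forall t, Rabs t < del -> Cmod (f t - f 0)%C < e.
Proof.
intros Hr [H1 H2] He; assert (H0 : Rabs 0 < r) by (rewrite Rabs_R0; easy).
destruct (continuous_R_eps _ 0 (e / 2) (smooth_continuous r _ 0 H1 H0) ltac:(lra))
  as (d1 & Hd1 & Hc1).
destruct (continuous_R_eps _ 0 (e / 2) (smooth_continuous r _ 0 H2 H0) ltac:(lra))
  as (d2 & Hd2 & Hc2).
exists (Rmin r (Rmin d1 d2)).
pose proof (Rmin_l r (Rmin d1 d2)); pose proof (Rmin_r r (Rmin d1 d2)).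
pose proof (Rmin_l d1 d2); pose proof (Rmin_r d1 d2).
split; [split; [repeat apply Rmin_pos; easy|easy]|].
intros t Ht; specialize (Hc1 t); specialize (Hc2 t); rewrite Rminus_0_r in Hc1, Hc2.
specialize (Hc1 ltac:(lra)); specialize (Hc2 ltac:(lra)).
eapply Rle_lt_trans; [apply Cmod_le_sum|].
change (Rabs (fst (f t) - fst (f 0)) + Rabs (snd (f t) - snd (f 0)) < e); lra.
Qed.

Lemma csmooth_bounded r f : 0 < r -> cpx (smooth r) f ->
  exists B del, 0 <= B /\ 0 < del <= r /\ forall t, Rabs t < del -> Cmod (f t) <= B.
Proof.
intros Hr Hf; destruct (csmooth_near_0 r f 1 Hr Hf Rlt_0_1) as (del & Hdel & H).
pose proof (Cmod_ge_0 (f 0)).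
exists (1 + Cmod (f 0)), del; split; [lra|split; [easy|]].
intros t Ht; specialize (H t Ht).
replace (f t) with (f t - f 0 + f 0)%C by ring.
eapply Rle_trans; [apply Cmod_triangle|]; lra.
Qed.

Lemma csmooth_bounded_below r f : 0 < r -> cpx (smooth r) f -> f 0 <> 0%C ->
  exists c del, 0 < c /\ 0 < del <= r /\ forall t, Rabs t < del -> c <= Cmod (f t).
Proof.
intros Hr Hf Hne; pose proof (proj1 (Cmod_gt_0 (f 0)) Hne) as Hc.
destruct (csmooth_near_0 r f (Cmod (f 0) / 2) Hr Hf ltac:(lra)) as (del & Hdel & H).
exists (Cmod (f 0) / 2), del; split; [lra|split; [easy|]].
intros t Ht; specialize (H t Ht).
assert (Cmod (f 0) <= Cmod (f t) + Cmod (f t - f 0)%C); [|lra].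
replace (f 0) with (f t + - (f t - f 0))%C at 1 by ring.
eapply Rle_trans; [apply Cmod_triangle|]; rewrite Cmod_opp; lra.
Qed.

Lemma csmooth_div r f : 0 < r -> cpx (smooth r) f -> f 0 = 0%C ->
  exists g, cpx (smooth r) g /\ forall t, f t = (RtoC t * g t)%C.
Proof.
intros Hr [H1 H2] H0.
assert (E1 : fst (f 0) = 0) by now rewrite H0.
assert (E2 : snd (f 0) = 0) by now rewrite H0.
exists (fun t => (divx (fun s => fst (f s)) t, divx (fun s => snd (f s)) t)); split.
- split; [apply (smooth_divx r (fun s => fst (f s)))|apply (smooth_divx r (fun s => snd (f s)))]; easy.
- intros t; apply injective_projections; simpl.
  + rewrite (divx_spec (fun s => fst (f s)) t E1) at 1; ring.
  + rewrite (divx_spec (fun s => snd (f s)) t E2) at 1; ring.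
Qed.

(** One factor t is divided off at a time; smoothness of [g] makes each intermediate quotient
    continuous. *)
Lemma ccm_div M r f g n : weight M -> 0 < r -> cpx (cm M r) f -> cpx (smooth r) g ->
  (forall t, Rabs t < r -> f t = (RtoC t ^ n * g t)%C) -> cpx (cm M r) g.
Proof.
intros HM Hr; assert (H0 : Rabs 0 < r) by (rewrite Rabs_R0; easy).
revert f g; induction n as [|n IH]; intros f g Hf Hg E.
- apply (cpx_ext_cm M r f); [|easy]; intros t Ht; rewrite E by easy; simpl; ring.
- apply (IH (fun t => RtoC t ^ n * g t)%C); [|easy|easy].
  assert (Hs : cpx (smooth r) (fun t => RtoC t ^ n * g t)%C).
  { apply cpx_mult; [apply subalg_smooth| |easy].
    apply cpx_RtoC; [apply subalg_smooth|apply smooth_id]. }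
  destruct Hf as [Hf1 Hf2], Hs as [Hs1 Hs2].
  split.
  + apply (cm_div_continuous M r (fun t => fst (f t))); try easy.
    * now apply (smooth_continuous r).
    * intros t Ht; rewrite E by easy; simpl; ring.
  + apply (cm_div_continuous M r (fun t => snd (f t))); try easy.
    * now apply (smooth_continuous r).
    * intros t Ht; rewrite E by easy; simpl; ring.
Qed.

(** [T] is a polynomial in t, which puts it in [cm] although f is merely smooth. *)
Lemma csmooth_taylor M r f n : weight M -> 0 < r -> cpx (smooth r) f ->
  exists T g, cpx (cm M r) T /\ cpx (smooth r) g /\
    forall t, f t = (T t + RtoC t ^ n * g t)%C.
Proof.
intros HM Hr; pose proof (subalg_cm M r HM) as HA; pose proof (subalg_smooth r) as HS.
revert f; induction n as [|n IH]; intros f Hf.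
- exists (fun _ => 0%C), f; split; [now apply cpx_const|split; [easy|]].
  intros t; simpl; ring.
- destruct (csmooth_div r (fun t => f t + - f 0)%C) as (g & Hg & Eg); [easy| |ring|].
  { apply cpx_plus; [easy|easy|now apply (cpx_const _ (- f 0)%C)]. }
  destruct (IH g Hg) as (T & g' & HT & Hg' & E).
  exists (fun t => f 0 + RtoC t * T t)%C, g'; split; [|split; [easy|]].
  + apply (cpx_plus _ (fun _ => f 0)); [easy|now apply cpx_const|].
    apply cpx_mult; [easy| |easy].
    exact (conj (cm_id M r HM) (cm_const M r 0 HM)).
  + intros t; replace (f t) with (f t + - f 0 + f 0)%C by ring.
    rewrite Eg, E; simpl; ring.
Qed.

(** * Flatness, finite order and roots of monic polynomials *)

Definition cflat (f : R -> C) : Prop := flat (fun t => Cmod (f t)).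

(** A lower bound instead of a factorisation t^n u, because it is also applied to cofactors whose
    regularity is not recorded. *)
Definition finite_order (f : R -> C) : Prop :=
  exists n c r, 0 < c /\ 0 < r /\
    forall t, t <> 0 -> Rabs t < r -> c * Rabs t ^ n <= Cmod (f t).

Lemma cflat_cm_zero M r f : weight M -> ratio_diverges M -> 0 < r ->
  cpx (cm M r) f -> cflat f -> forall t, Rabs t < r -> f t = 0%C.
Proof.
intros HM Hd Hr [H1 H2] Hf t Ht.
assert (Hle : forall z, Rabs (fst z) <= Cmod z /\ Rabs (snd z) <= Cmod z).
{ intros z; pose proof (Rmax_Cmod z); pose proof (Rmax_l (Rabs (fst z)) (Rabs (snd z))).
  pose proof (Rmax_r (Rabs (fst z)) (Rabs (snd z))); lra. }
apply injective_projections; simpl.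
- apply (denjoy_carleman M r (fun t => fst (f t))); try easy.
  intros n; destruct (Hf n) as (B & r1 & Hr1 & HB); exists B, r1; split; [easy|].
  intros s Hs0 Hs; eapply Rle_trans; [apply Hle|].
  eapply Rle_trans; [apply Rle_abs|now apply HB].
- apply (denjoy_carleman M r (fun t => snd (f t))); try easy.
  intros n; destruct (Hf n) as (B & r1 & Hr1 & HB); exists B, r1; split; [easy|].
  intros s Hs0 Hs; eapply Rle_trans; [apply Hle|].
  eapply Rle_trans; [apply Rle_abs|now apply HB].
Qed.

(** Division by t is repeated while the quotient vanishes at 0. If it never stops, f = t^n u_n with
    u_n bounded near 0 for every n, which is flatness. *)
Lemma csmooth_order r f : 0 < r -> cpx (smooth r) f ->
  (exists n u, cpx (smooth r) u /\ u 0 <> 0%C /\ forall t, f t = (RtoC t ^ n * u t)%C)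
  \/ cflat f.
Proof.
intros Hr Hf.
destruct (classic (exists n u, cpx (smooth r) u /\ u 0 <> 0%C /\
   forall t, f t = (RtoC t ^ n * u t)%C)) as [|Hn]; [now left|right].
intros n.
assert (Hu : exists u, cpx (smooth r) u /\ forall t, f t = (RtoC t ^ n * u t)%C).
{ induction n as [|n (u & Hu & Eu)].
  - exists f; split; [easy|]; intros t; simpl; ring.
  - destruct (classic (u 0 = 0%C)) as [E|E].
    + destruct (csmooth_div r u Hr Hu E) as (g & Hg & Eg).
      exists g; split; [easy|]; intros t; rewrite Eu, Eg; simpl; ring.
    + exfalso; apply Hn; exists n, u; easy. }
destruct Hu as (u & Hu & Eu).
destruct (csmooth_bounded r u Hr Hu) as (B & del & HB & Hdel & Hb).
exists B, del; split; [easy|]; intros t _ Ht.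
rewrite Eu, Cmod_mult, Cmod_pow, Cmod_R, Rabs_pos_eq.
- rewrite Rmult_comm; apply Rmult_le_compat_r; [apply pow_le, Rabs_pos|auto].
- apply Rmult_le_pos; [apply pow_le, Rabs_pos|apply Cmod_ge_0].
Qed.

Lemma order_finite r n u f : 0 < r -> cpx (smooth r) u -> u 0 <> 0%C ->
  (forall t, f t = (RtoC t ^ n * u t)%C) -> finite_order f.
Proof.
intros Hr Hu Hne Eu.
destruct (csmooth_bounded_below r u Hr Hu Hne) as (c & del & Hc & Hdel & Hb).
exists n, c, del; split; [easy|split; [easy|]]; intros t _ Ht.
rewrite Eu, Cmod_mult, Cmod_pow, Cmod_R, Rmult_comm.
apply Rmult_le_compat_l; [apply pow_le, Rabs_pos|auto].
Qed.

Lemma finite_order_dominates f g : finite_order f -> cflat g ->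
  exists del, 0 < del /\ forall t, t <> 0 -> Rabs t < del -> Cmod (g t) < Cmod (f t).
Proof.
intros (n & c & r & Hc & Hr & Hf) Hg.
destruct (Hg (S n)) as (B & r1 & Hr1 & HB).
pose proof (Rabs_pos B) as HB0.
exists (Rmin (Rmin r r1) (c / (Rabs B + 1))).
assert (Hq : 0 < c / (Rabs B + 1)) by (apply Rdiv_lt_0_compat; lra).
split; [repeat apply Rmin_pos; easy|]; intros t Ht0 Ht.
pose proof (Rmin_l (Rmin r r1) (c / (Rabs B + 1))).
pose proof (Rmin_r (Rmin r r1) (c / (Rabs B + 1))).
pose proof (Rmin_l r r1); pose proof (Rmin_r r r1).
specialize (Hf t Ht0 ltac:(lra)); specialize (HB t Ht0 ltac:(lra)).
rewrite Rabs_pos_eq in HB by apply Cmod_ge_0.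
eapply Rle_lt_trans; [exact HB|]; eapply Rlt_le_trans; [|exact Hf].
pose proof (Rabs_pos_lt t Ht0) as Hp.
simpl pow; rewrite <- Rmult_assoc; apply Rmult_lt_compat_r; [apply pow_lt; easy|].
apply Rle_lt_trans with (Rabs B * Rabs t).
- apply Rmult_le_compat_r; [lra|apply Rle_abs].
- apply Rle_lt_trans with ((Rabs B + 1) * Rabs t); [nra|].
  apply Rlt_le_trans with ((Rabs B + 1) * (c / (Rabs B + 1))); [|right; field; lra].
  apply Rmult_lt_compat_l; lra.
Qed.

Lemma finite_order_not_flat f : finite_order f -> ~ cflat f.
Proof.
intros H1 H2; destruct (finite_order_dominates f f H1 H2) as (del & Hdel & H).
specialize (H (del / 2) ltac:(lra)); rewrite Rabs_pos_eq in H by lra.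
specialize (H ltac:(lra)); lra.
Qed.

Lemma finite_order_mult f g : finite_order f -> finite_order g ->
  finite_order (fun t => f t * g t)%C.
Proof.
intros (n & c & r & Hc & Hr & Hf) (n' & c' & r' & Hc' & Hr' & Hg).
exists (n + n')%nat, (c * c'), (Rmin r r'); split; [nra|split; [now apply Rmin_pos|]].
intros t Ht0 Ht; pose proof (Rmin_l r r'); pose proof (Rmin_r r r').
rewrite Cmod_mult, pow_add.
replace (c * c' * (Rabs t ^ n * Rabs t ^ n')) with
  (c * Rabs t ^ n * (c' * Rabs t ^ n')) by ring.
apply Rmult_le_compat; try (apply Rmult_le_pos; [lra|apply pow_le, Rabs_pos]).
- apply Hf; [easy|lra].
- apply Hg; [easy|lra].
Qed.

Lemma cflat_mult_bounded r f g : 0 < r -> cflat f -> cpx (smooth r) g ->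
  cflat (fun t => f t * g t)%C.
Proof.
intros Hr Hf Hg n; destruct (Hf n) as (B & r1 & Hr1 & HB).
destruct (csmooth_bounded r g Hr Hg) as (B' & del & HB' & Hdel & Hb).
exists (B * B'), (Rmin r1 del); split; [now apply Rmin_pos|].
intros t Ht0 Ht; pose proof (Rmin_l r1 del); pose proof (Rmin_r r1 del).
rewrite Cmod_mult, Rabs_mult, (Rabs_pos_eq (Cmod (g t))) by apply Cmod_ge_0.
replace (B * B' * Rabs t ^ n) with (B * Rabs t ^ n * B') by ring.
apply Rmult_le_compat; [apply Rabs_pos|apply Cmod_ge_0|apply HB; [easy|lra]|apply Hb; lra].
Qed.

(** Horner form, constant coefficient first, leading coefficient 1 implicit: removing a vanishing
    head divides by z and stays monic. *)
Fixpoint zmonic (l : list (R -> C)) : zp :=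
  match l with
  | nil => ZC (fun _ => 1%C)
  | a :: l => ZAdd (ZC a) (ZMul ZX (zmonic l))
  end.

Lemma zpin_zmonic P l : subalg P -> Forall (cpx P) l -> zpin P (zmonic l).
Proof.
intros HP; induction 1 as [|a l Ha _ IH]; simpl; [now apply cpx_const|easy].
Qed.

(** The root equation is required pointwise in t, because it can be divided by w only where w t <>
    0, and the induction hypothesis must accept such isolated points. *)
Lemma flat_root_zero M r l w : weight M -> ratio_diverges M -> 0 < r ->
  Forall (cpx (cm M r)) l -> cpx (smooth r) w -> cflat w ->
  exists del, 0 < del /\
    forall t, t <> 0 -> Rabs t < del -> ev (zmonic l) t (w t) = 0%C -> w t = 0%C.
Proof.
intros HM Hdiv Hr Hl Hw Hfl.
assert (Hsm : forall g, cpx (cm M r) g -> cpx (smooth r) g).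
{ intros g; apply cpx_imp; intros u; apply cm_smooth. }
induction Hl as [|a l Ha Hl (del & Hdel & IH)].
- exists 1; split; [lra|]; simpl; intros t _ _ E; exfalso.
  apply RtoC_inj in E; lra.
- destruct (csmooth_order r a Hr (Hsm a Ha)) as [(n & u & Hu & Hu0 & Eu)|Haf].
  + pose proof (order_finite r n u a Hr Hu Hu0 Eu) as Hfin.
    destruct (finite_order_dominates a (fun t => w t * at_fun (zmonic l) w t)%C Hfin)
      as (del' & Hdel' & Hdom).
    { apply (cflat_mult_bounded r); try easy.
      apply cpx_at_fun; [apply subalg_smooth| |easy].
      apply zpin_zmonic; [apply subalg_smooth|].
      revert Hl; apply Forall_impl; exact Hsm. }
    exists del'; split; [easy|]; simpl; intros t Ht0 Ht E; exfalso.
    specialize (Hdom t Ht0 Ht); unfold at_fun in Hdom.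
    set (v := (w t * ev (zmonic l) t (w t))%C) in *.
    assert (Ea : a t = (- v)%C).
    { replace (a t) with (a t + v + - v)%C by ring; rewrite E; ring. }
    rewrite Ea, Cmod_opp in Hdom; lra.
  + pose proof (cflat_cm_zero M r a HM Hdiv Hr Ha Haf) as Ha0.
    exists (Rmin r del); split; [now apply Rmin_pos|].
    pose proof (Rmin_l r del); pose proof (Rmin_r r del).
    simpl; intros t Ht0 Ht E; rewrite Ha0 in E by lra.
    destruct (classic (w t = 0%C)) as [|Hne]; [easy|].
    apply IH; [easy|lra|].
    rewrite Cplus_0_l in E.
    replace (ev (zmonic l) t (w t)) with (/ w t * (w t * ev (zmonic l) t (w t)))%C
      by (field; easy).
    rewrite E; ring.
Qed.

Lemma csmooth_cderiv r h : cpx (smooth r) h ->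
  exists h', forall t, Rabs t < r -> cderiv h t (h' t).
Proof.
intros [H1 H2]; destruct (H1 1%nat) as (d & Hd0 & Hd); destruct (H2 1%nat) as (e & He0 & He).
exists (fun t => (INR 1 * d 1%nat t, INR 1 * e 1%nat t)); intros t Ht; split.
- apply (is_derive_eq_on r (d 0%nat)); auto.
- apply (is_derive_eq_on r (e 0%nat)); auto.
Qed.

(* Newton's method in the form of Tougeron's implicit function theorem: if dQ/dz has
   order k along f, the substitution z = T + t^k h, with T a Taylor polynomial of f,
   turns Q = 0 into an equation with invertible linear part for h. *)
Theorem cm_simple_root M r Q f : weight M -> 0 < r -> zpin (cm M r) Q ->
  cpx (smooth r) f -> (forall t, Rabs t < r -> ev Q t (f t) = 0%C) ->
  finite_order (at_fun (dz Q) f) ->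
  exists r', 0 < r' <= r /\ cpx (cm M r') f.
Proof.
intros HM Hr HQ Hf HQ0 Hord.
pose proof (subalg_cm M r HM) as HA; pose proof (subalg_smooth r) as HS.
assert (Hsm : forall g, cm M r g -> smooth r g) by (intros u; apply cm_smooth).
assert (HQs : zpin (smooth r) Q) by (apply (zpin_imp (cm M r)); easy).
destruct (csmooth_order r (at_fun (dz Q) f) Hr) as [(k & u0 & Hu0 & Hu00 & Eu0)|Hfl].
{ apply cpx_at_fun; try easy; now apply zpin_dz. }
2: { now apply finite_order_not_flat in Hord. }
(* Order k+1 rather than k, so that h = t g vanishes at 0. *)
destruct (csmooth_taylor M r f (S k) HM Hr Hf) as (T & g & HT & Hg & ET).
set (h := fun t => (RtoC t * g t)%C).
assert (Hh : cpx (smooth r) h).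
{ apply cpx_mult; try easy; exact (conj (smooth_id r) (proj1 HS 0)). }
assert (Hh0 : h 0 = 0%C) by (unfold h; ring).
set (s := fun t => (RtoC t ^ k)%C).
assert (Hs : cpx (cm M r) s) by (apply cpx_RtoC; [easy|now apply cm_id]).
assert (Hss : cpx (smooth r) s) by now apply (cpx_imp (cm M r)).
assert (HTs : cpx (smooth r) T) by now apply (cpx_imp (cm M r)).
assert (Ef : forall t, f t = (T t + s t * h t)%C).
{ intros t; rewrite ET; unfold s, h; simpl; ring. }
assert (Hoh : cpx (smooth r) (fun t => - h t)%C).
{ split; [apply (subalg_opp (smooth r) (fun t => fst (h t)))|
          apply (subalg_opp (smooth r) (fun t => snd (h t)))]; try easy; apply Hh. }
(* Taylor expansion of dQ/dz at f with increment - s h gives dQ/dz (T) = s u. All corrections to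
   [u0] carry a factor h, so u 0 = u0 0. *)
set (u := fun t => (u0 t + ((- h t) * at_fun (dz (dz Q)) f t
            + s t * ((- h t) * ((- h t) * at_fun (zrem (dz Q) f s) (fun t => - h t)%C t))))%C).
assert (Hus : cpx (smooth r) u).
{ apply (cpx_plus _ u0); [easy|easy|].
  apply (cpx_plus _ (fun t => - h t * at_fun (dz (dz Q)) f t)%C); [easy| |].
  - apply (cpx_mult _ (fun t => - h t)%C); [easy|easy|].
    apply cpx_at_fun; try easy; apply zpin_dz, zpin_dz; easy.
  - apply (cpx_mult _ s); [easy|easy|].
    apply (cpx_mult _ (fun t => - h t)%C); [easy|easy|].
    apply (cpx_mult _ (fun t => - h t)%C); [easy|easy|].
    apply cpx_at_fun; try easy; apply zpin_zrem; try easy; now apply zpin_dz. }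
assert (Hu0' : u 0 <> 0%C).
{ unfold u; rewrite Hh0.
  match goal with |- ?v <> _ => replace v with (u0 0) by ring end; easy. }
assert (Eu : forall t, ev (dz Q) t (T t) = (s t * u t)%C).
{ intros t; replace (T t) with (f t + s t * - h t)%C by (rewrite Ef; ring).
  rewrite ev_taylor; fold (at_fun (dz Q) f t); rewrite Eu0; unfold u, s, at_fun; ring. }
assert (Huc : cpx (cm M r) u).
{ apply (ccm_div M r (at_fun (dz Q) T) u k); try easy.
  - apply cpx_at_fun; try easy; now apply zpin_dz.
  - intros t _; apply Eu. }
assert (HR : zpin (cm M r) (zrem Q T s)) by (apply zpin_zrem; easy).
(* Expanding Q(T + s h) = 0 gives Q(T) = t^(2k) b. So b is C^M by division, and h solves b + h u +
   h^2 R(h) = 0, whose z-derivative at h = 0, t = 0 is u 0. *)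
set (b := fun t => ((-1) * (h t * u t + h t * (h t * at_fun (zrem Q T s) h t)))%C).
assert (Hbs : cpx (smooth r) b).
{ apply (cpx_mult _ (fun _ => (-1)%C)); [easy|now apply cpx_const|].
  apply (cpx_plus _ (fun t => h t * u t)%C); [easy|now apply cpx_mult|].
  apply (cpx_mult _ h); [easy|easy|]; apply (cpx_mult _ h); [easy|easy|].
  apply cpx_at_fun; try easy; now apply (zpin_imp (cm M r)). }
assert (Hbc : cpx (cm M r) b).
{ apply (ccm_div M r (at_fun Q T) b (k + k)); try easy; [now apply cpx_at_fun|].
  intros t Ht; pose proof (HQ0 t Ht) as E; rewrite Ef, ev_taylor, Eu in E.
  rewrite Cpow_add_r; fold (s t); unfold b, at_fun in *.
  match type of E with (?x + ?y + ?z)%C = _ =>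
    replace (ev Q t (T t)) with ((x + y + z) + (-1) * (y + z))%C by ring end.
  rewrite E; ring. }
destruct (csmooth_cderiv r h Hh) as (h' & Hh').
destruct (cm_implicit M r
  (ZAdd (ZC b) (ZAdd (ZMul ZX (ZC u)) (ZMul ZX (ZMul ZX (zrem Q T s))))) h h')
  as (r' & Hr' & Hhc); try easy.
- intros t Ht; simpl; unfold b, at_fun; ring.
- simpl; rewrite Hh0.
  match goal with |- ?v <> _ => replace v with (u 0) by ring end; easy.
- exists r'; split; [easy|].
  pose proof (subalg_cm M r' HM) as HA'.
  assert (Hle : forall g, cm M r g -> cm M r' g) by (intros; apply (cm_le M r); lra || easy).
  apply (cpx_ext_cm M r' (fun t => T t + s t * h t)%C); [intros; now rewrite Ef|].
  apply cpx_plus; [easy|now apply (cpx_imp (cm M r))|].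
  apply cpx_mult; [easy|now apply (cpx_imp (cm M r))|easy].
Qed.

Fixpoint root_prod (fs : list (R -> C)) (t : R) (z : C) : C :=
  match fs with nil => 1%C | g :: fs => ((z + - g t) * root_prod fs t z)%C end.

(** [e] counts the members equal to f near 0; the other factors go into [q], which along f is a
    product of functions of finite order. *)
Lemma root_prod_split f fs :
  Forall (fun g => (exists del, 0 < del /\ forall t, Rabs t < del -> g t = f t) \/
                   finite_order (fun t => f t + - g t)%C) fs ->
  exists e q del, 0 < del /\ finite_order (at_fun q f) /\
    forall t z, Rabs t < del -> root_prod fs t z = ((z + - f t) ^ e * ev q t z)%C.
Proof.
induction 1 as [|g fs Hg _ (e & q & del & Hdel & Hq & E)].
- exists 0%nat, (ZC (fun _ => 1%C)), 1; split; [lra|split].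
  + exists 0%nat, 1, 1; split; [lra|split; [lra|]]; intros t _ _; unfold at_fun; simpl.
    rewrite Cmod_1; lra.
  + intros; simpl; ring.
- destruct Hg as [(d & Hd & Eg)|Hg].
  + exists (S e), q, (Rmin d del); split; [now apply Rmin_pos|split; [easy|]].
    pose proof (Rmin_l d del); pose proof (Rmin_r d del).
    intros t z Ht; simpl; rewrite E, Eg by lra; ring.
  + exists e, (ZMul (ZAdd ZX (ZC (fun t => - g t)%C)) q), del; split; [easy|split].
    * exact (finite_order_mult _ _ Hg Hq).
    * intros t z Ht; simpl; rewrite E by easy; ring.
Qed.

Lemma flat_difference_zero M r l f g : weight M -> ratio_diverges M -> 0 < r ->
  Forall (cpx (cm M r)) l -> cpx (smooth r) f -> cpx (smooth r) g ->
  (forall t, Rabs t < r -> ev (zmonic l) t (f t + - g t)%C = 0%C) ->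
  (exists del, 0 < del /\ forall t, Rabs t < del -> g t = f t) \/
  finite_order (fun t => f t + - g t)%C.
Proof.
intros HM Hdiv Hr Hl Hf Hg E.
set (w := fun t => (f t + - g t)%C).
assert (Hw : cpx (smooth r) w).
{ destruct Hf as [Hf1 Hf2], Hg as [Hg1 Hg2]; split.
  - exact (subalg_minus _ _ _ (subalg_smooth r) Hf1 Hg1).
  - exact (subalg_minus _ _ _ (subalg_smooth r) Hf2 Hg2). }
destruct (csmooth_order r w Hr Hw) as [(n & u & Hu & Hu0 & Eu)|Hfl].
{ right; now apply (order_finite r n u). }
left; destruct (flat_root_zero M r l w HM Hdiv Hr Hl Hw Hfl) as (del & Hdel & H).
exists (Rmin r del); split; [now apply Rmin_pos|].
pose proof (Rmin_l r del); pose proof (Rmin_r r del).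
assert (Hw0 : forall t, t <> 0 -> Rabs t < Rmin r del -> w t = 0%C).
{ intros t Ht0 Ht; apply H; [easy|lra|apply E; lra]. }
(* [flat_root_zero] excludes t = 0; continuity supplies this value. *)
assert (Hwz : forall t, Rabs t < Rmin r del -> w t = 0%C).
{ intros t Ht; destruct (Req_dec t 0) as [->|Ht0]; [|now apply Hw0].
  apply NNPP; intros Hne.
  destruct (csmooth_bounded_below r w Hr Hw Hne) as (c & d & Hc & Hd & Hb).
  set (t := Rmin (Rmin r del) d / 2).
  pose proof (Rmin_pos _ _ (Rmin_pos _ _ Hr Hdel) (proj1 Hd)).
  pose proof (Rmin_l (Rmin r del) d); pose proof (Rmin_r (Rmin r del) d).
  assert (Hta : Rabs t = t) by (apply Rabs_pos_eq; unfold t; lra).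
  specialize (Hb t ltac:(rewrite Hta; unfold t; lra)).
  rewrite Hw0, Cmod_0 in Hb; [lra|unfold t; lra|rewrite Hta; unfold t; lra]. }
intros t Ht; specialize (Hwz t Ht); unfold w in Hwz.
replace (f t) with (f t + - g t + g t)%C by ring; rewrite Hwz; ring.
Qed.

Theorem smooth_root_cm M r l f fs : weight M -> ratio_diverges M -> 0 < r ->
  Forall (cpx (cm M r)) l -> cpx (smooth r) f -> Forall (cpx (smooth r)) fs ->
  (forall t z, Rabs t < r -> ev (zmonic l) t z = root_prod fs t z) ->
  (forall t, Rabs t < r -> ev (zmonic l) t (f t) = 0%C) ->
  Forall (fun g => exists l', Forall (cpx (cm M r)) l' /\
    forall t, Rabs t < r -> ev (zmonic l') t (f t + - g t)%C = 0%C) fs ->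
  exists r', 0 < r' <= r /\ cpx (cm M r') f.
Proof.
intros HM Hdiv Hr Hl Hf Hfs Eprod Eroot Hdiff.
destruct (root_prod_split f fs) as (e & q & del & Hdel & Hq & E).
{ rewrite Forall_forall in Hdiff, Hfs |- *; intros g Hg.
  destruct (Hdiff g Hg) as (l' & Hl' & El').
  apply (flat_difference_zero M r l'); auto. }
pose proof (Rmin_l r del); pose proof (Rmin_r r del).
assert (Hr1 : 0 < Rmin r del) by now apply Rmin_pos.
set (r1 := Rmin r del) in *.
assert (E1 : forall t z, Rabs t < r1 -> ev (zmonic l) t z = ((z + - f t) ^ e * ev q t z)%C).
{ intros t z Ht; rewrite Eprod, E by lra; easy. }
destruct e as [|e].
(* Multiplicity 0 would give P(f) = q(f), which vanishes although q(f) has finite order. *)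
{ exfalso; destruct Hq as (n & c & d & Hc & Hd & Hb).
  set (t := Rmin r1 d / 2).
  pose proof (Rmin_pos _ _ Hr1 Hd); pose proof (Rmin_l r1 d); pose proof (Rmin_r r1 d).
  assert (Ht0 : 0 < t) by (unfold t; lra).
  assert (Hta : Rabs t = t) by (apply Rabs_pos_eq; lra).
  specialize (Hb t ltac:(lra) ltac:(rewrite Hta; unfold t; lra)).
  specialize (E1 t (f t) ltac:(rewrite Hta; unfold t; lra)).
  rewrite Eroot in E1 by (rewrite Hta; unfold t; lra).
  unfold at_fun in Hb; simpl in E1; rewrite Cmult_1_l in E1; rewrite <- E1, Cmod_0, Hta in Hb.
  pose proof (pow_lt t n Ht0); nra. }
assert (Hle : forall g, cm M r g -> cm M r1 g) by (intros; apply (cm_le M r); easy).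
destruct (cm_simple_root M r1 (dzn e (zmonic l)) f) as (r' & Hr' & Hf'); try easy.
- apply zpin_dzn; [now apply subalg_cm|].
  apply zpin_zmonic; [now apply subalg_cm|].
  revert Hl; apply Forall_impl; intros g; now apply cpx_imp.
- apply (cpx_imp (smooth r)); [|easy]; intros g; now apply smooth_le.
- intros t Ht; apply (ev_dzn_multiple_root e (zmonic l) q t (f t)).
  intros z; now apply E1.
- rewrite dz_dzn; destruct Hq as (n & c & d & Hc & Hd & Hb).
  exists n, c, (Rmin d r1); split; [easy|split; [now apply Rmin_pos|]].
  pose proof (Rmin_l d r1); pose proof (Rmin_r d r1).
  intros t Ht0 Ht; specialize (Hb t Ht0 ltac:(lra)).
  destruct (ev_dzn_multiple_root e (zmonic l) q t (f t)) as [_ Hd2].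
  { intros z; apply E1; lra. }
  unfold at_fun in *; rewrite Hd2, Cmod_mult, Cmod_R, (Rabs_pos_eq (INR _)) by apply pos_INR.
  assert (1 <= INR (fact (S e))).
  { apply (le_INR 1); pose proof (lt_O_fact (S e)); lia. }
  pose proof (Cmod_ge_0 (ev q t (f t))); nra.
- exists r'; split; [lra|easy].
Qed.

(** * Translation between derivative sequences and jets *)

Lemma INR_fact_pos k : 0 < INR (fact k).
Proof. apply lt_0_INR, lt_O_fact. Qed.

Lemma sym_interval_Rabs r t : sym_interval r t <-> Rabs t < r.
Proof.
unfold sym_interval; split; [intros [H1 H2]; apply Rabs_def1; lra|].
intros H; apply Rabs_def2 in H; lra.
Qed.

Lemma derivs_on_jet r f D K : derivs_on (sym_interval r) f D ->
  jet r K f (fun k x => / INR (fact k) * D k x).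
Proof.
intros [H0 H]; split.
- intros x Hx; rewrite H0 by now apply sym_interval_Rabs.
  simpl; rewrite Rinv_1; ring.
- intros k x _ Hx; pose proof (INR_fact_pos k); pose proof (INR_S_pos k).
  replace (INR (S k) * (/ INR (fact (S k)) * D (S k) x)) with (/ INR (fact k) * D (S k) x).
  + apply (is_derive_scal (D k)), is_derive_Reals, H; now apply sym_interval_Rabs.
  + change (fact (S k)) with (S k * fact k)%nat; rewrite mult_INR; field; lra.
Qed.

Lemma Cinf_on_smooth r f : Cinf_on (sym_interval r) f -> smooth r f.
Proof. intros [D HD] K; eexists; apply derivs_on_jet; exact HD. Qed.

Lemma CM_on_cm M r f : weight M -> 0 < r -> CM_on M (sym_interval r) f -> cm M (r / 2) f.
Proof.
intros HM Hr (D & HD & Hb).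
destruct (Hb (fun x => - (r / 2) <= x <= r / 2)) as (Cc & rho & HC & Hrho & Hbd).
- intros x Hx; unfold sym_interval; lra.
- apply compact_P3.
- set (b := Rmax 1 rho); assert (Hb1 : 1 <= b) by apply Rmax_l.
  assert (Hb2 : rho <= b) by apply Rmax_r.
  (* The extra 4^k dominates the denominator (k+1)^2 of [W M k]. *)
  exists Cc, (4 * b); repeat split; try lra; intros K.
  exists (fun k x => / INR (fact k) * D k x); split.
  { apply (jet_le r (r / 2) K K); [lra|lia|now apply derivs_on_jet]. }
  intros k x _ Hx; apply Rabs_def2 in Hx; specialize (Hbd k x ltac:(lra)).
  pose proof (INR_fact_pos k) as Hk; pose proof (weight_pos M HM k).
  rewrite Rabs_mult, Rabs_inv, (Rabs_pos_eq (INR _)) by lra.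
  apply Rmult_le_reg_l with (INR (fact k)); [easy|].
  rewrite <- Rmult_assoc, Rinv_r, Rmult_1_l by lra.
  eapply Rle_trans; [exact Hbd|].
  replace (Cc * rho ^ k * INR (fact k) * M k) with (INR (fact k) * (Cc * (rho ^ k * M k))) by ring.
  rewrite (Rmult_assoc Cc).
  apply Rmult_le_compat_l; [lra|]; apply Rmult_le_compat_l; [lra|].
  rewrite Rpow_mult_distr, Rmult_comm, (Rmult_comm (4 ^ k)), (Rmult_assoc (b ^ k)), (Rmult_comm (M k)).
  apply Rmult_le_compat; [apply pow_le; lra|lra|apply pow_incr; lra|].
  unfold W; pose proof (INR_S_pos k) as HSk; pose proof (INR_S_le_pow2 k) as H2.
  apply Rmult_le_reg_r with (INR (S k) ^ 2); [apply pow_lt; easy|].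
  replace (4 ^ k * (M k / INR (S k) ^ 2) * INR (S k) ^ 2) with (M k * 4 ^ k) by (field; lra).
  apply Rmult_le_compat_l; [lra|].
  replace (4 ^ k) with ((2 ^ k) ^ 2).
  + apply pow_incr; lra.
  + rewrite <- pow_mult, Nat.mul_comm, pow_mult; f_equal; lra.
Qed.

Lemma cm_CM_on M r f : weight M -> cm M r f -> CM_on M (sym_interval r) f.
Proof.
intros HM (A & b & HA & Hb & H).
(* Choice picks one jet for each order; the diagonal [d k k] is a coherent sequence of derivatives
   by [jet_unique]. *)
destruct (functional_choice (fun K d => jet r K f d /\
  forall k x, (k <= K)%nat -> Rabs x < r -> Rabs (d k x) <= A * b ^ k * W M k) H) as [d Hd].
exists (fun k x => INR (fact k) * d k k x); split; [split|].
- intros x Hx; apply sym_interval_Rabs in Hx; destruct (Hd 0%nat) as [[H0 _] _].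
  rewrite H0 by easy; simpl; ring.
- intros k x Hx; apply sym_interval_Rabs in Hx; apply is_derive_Reals.
  destruct (Hd k) as [Hk _]; destruct (Hd (S k)) as [HSk _].
  replace (INR (fact (S k)) * d (S k) (S k) x) with
    (INR (fact k) * (INR (S k) * d (S k) (S k) x))
    by (change (fact (S k)) with (S k * fact k)%nat; rewrite mult_INR; ring).
  apply (is_derive_scal (d k k)).
  apply (is_derive_eq_on r (d (S k) k)); [|easy|apply HSk; [lia|easy]].
  intros y Hy; apply (jet_unique r k f); try easy.
  apply (jet_le r r (S k)); [lra|lia|easy].
(* [CM_on] asks for a positive constant, and A may be 0. *)
- intros K HK _; exists (A + 1), b; split; [lra|split; [lra|]]; intros k x Hx.
  apply HK in Hx; apply sym_interval_Rabs in Hx.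
  destruct (Hd k) as [_ Hbd]; specialize (Hbd k x (le_n k) Hx).
  pose proof (INR_fact_pos k) as Hf; pose proof (W_le M HM k); pose proof (W_pos M HM k).
  pose proof (pow_lt b k ltac:(lra)).
  rewrite Rabs_mult, (Rabs_pos_eq (INR _)) by lra.
  replace ((A + 1) * b ^ k * INR (fact k) * M k) with (INR (fact k) * ((A + 1) * b ^ k * M k)) by ring.
  apply Rmult_le_compat_l; [lra|]; eapply Rle_trans; [exact Hbd|].
  apply Rmult_le_compat; try lra; apply Rmult_le_pos; lra.
Qed.

Lemma DC_weight_weight M : DC_weight M -> weight M.
Proof.
intros (H0 & Hp & Hi & Hc & B & HB); constructor; try easy.
- intros k; specialize (Hc (S k) eq_refl).
  replace (M k) with (M (ssrnat.subn (S k) 1)); [exact Hc|].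
  f_equal; unfold ssrnat.subn; simpl; destruct k; reflexivity.
(* The root condition starts at k = 1; for k = 0 the bound is M 1 <= B1, and for k >= 1 the exponent
   k may be raised to k+1 because B1 >= 1. *)
- set (B1 := Rmax 1 (Rmax B (M 1%nat))).
  assert (HB1 : 1 <= B1) by apply Rmax_l.
  assert (HB2 : B <= B1) by (eapply Rle_trans; [apply Rmax_l|apply Rmax_r]).
  assert (HB3 : M 1%nat <= B1) by (eapply Rle_trans; [apply Rmax_r|apply Rmax_r]).
  exists B1; split; [easy|]; intros [|k]; [rewrite H0; simpl; lra|].
  specialize (HB (S k) eq_refl).
  pose proof (Hp (S k)); pose proof (Hp (S (S k))); pose proof (INR_S_pos k).
  set (x := M (S (S k)) / M (S k)) in *.
  assert (Hx : 0 < x) by now apply Rdiv_lt_0_compat.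
  assert (Hxk : x = Rpower x (/ INR (S k)) ^ S k).
  { rewrite <- Rpower_pow by apply exp_pos.
    rewrite Rpower_mult, Rinv_l, Rpower_1 by lra; reflexivity. }
  assert (Hle : x <= B1 ^ S (S k)).
  { rewrite Hxk; apply Rle_trans with (B1 ^ S k).
    - apply pow_incr; split; [left; apply exp_pos|lra].
    - apply Rle_pow; [easy|lia]. }
  replace (M (S (S k))) with (x * M (S k)) by (unfold x; field; lra).
  apply Rmult_le_compat_r; lra.
Qed.

(** * Polynomial invariants *)

Fixpoint pv (n : nat) (c : nat -> C) (z : C) : C :=
  match n with O => c 0%nat | S n => (c 0%nat + z * pv n (fun i => c (S i)) z)%C end.

Lemma pv_last n (c : nat -> C) (z : C) : c (S n) = 0%C -> pv (S n) c z = pv n c z.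
Proof.
revert c; induction n as [|n IH]; intros c H.
- simpl; rewrite H; ring.
- change (pv (S (S n)) c z) with (c 0%nat + z * pv (S n) (fun i => c (S i)) z)%C.
  rewrite IH by exact H; reflexivity.
Qed.

Lemma pv_linear n (a : C) (c c' : nat -> C) (z : C) :
  pv n (fun i => c i + a * c' i)%C z = (pv n c z + a * pv n c' z)%C.
Proof.
revert c c'; induction n as [|n IH]; intros c c'; simpl; [reflexivity|].
rewrite (IH (fun i => c (S i)) (fun i => c' (S i))); ring.
Qed.

(* [csym s] lists the coefficients of the product of the z - a, for a in s. *)
Fixpoint csym (s : list C) (i : nat) : C :=
  match s, i with
  | nil, O => 1%C
  | nil, S _ => 0%C
  | a :: s, O => (-1 * a * csym s 0)%C
  | a :: s, S i => (csym s i + -1 * a * csym s (S i))%C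
  end.

Lemma csym_top s : csym s (length s) = 1%C /\
  forall i, (length s < i)%nat -> csym s i = 0%C.
Proof.
induction s as [|a s [IH1 IH2]]; simpl.
- split; [reflexivity|]; intros [|i] Hi; [lia|reflexivity].
- split; [rewrite IH1, IH2 by lia; ring|].
  intros [|i] Hi; [lia|]; rewrite !IH2 by lia; ring.
Qed.

Lemma csym_permutation s s' : Permutation s s' -> forall i, csym s i = csym s' i.
Proof.
induction 1 as [|a s s' _ IH|a b s|s s' s'' _ IH1 _ IH2]; intros i.
- reflexivity.
- destruct i; simpl; rewrite !IH; reflexivity.
- destruct i as [|[|i]]; simpl; ring.
- rewrite IH1; apply IH2.
Qed.

Fixpoint rprod (s : list C) (z : C) : C :=
  match s with nil => 1%C | a :: s => ((z + - a) * rprod s z)%C end.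

Lemma pv_csym s z : pv (length s) (csym s) z = rprod s z.
Proof.
induction s as [|a s IH]; [reflexivity|].
change (pv (length (a :: s)) (csym (a :: s)) z) with
  (-1 * a * csym s 0 + z * pv (length s) (fun i => csym s i + (-1 * a) * csym s (S i)) z)%C.
rewrite (pv_linear _ _ (csym s) (fun i => csym s (S i))).
simpl rprod; rewrite <- IH.
pose proof (pv_last (length s) (csym s) z (proj2 (csym_top s) _ (Nat.lt_succ_diag_r _))) as H.
simpl in H.
set (v := pv (length s) (csym s) z) in *.
set (v1 := pv (length s) (fun i => csym s (S i)) z) in *.
replace (-1 * a * csym s 0 + z * (v + -1 * a * v1))%C with
  (z * v + -1 * a * (csym s 0 + z * v1))%C by ring.
rewrite H; ring.
Qed.

Lemma ev_zmonic_pv n : forall (F : nat -> R -> C) t z, F n t = 1%C ->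
  ev (zmonic (map F (seq 0 n))) t z = pv n (fun i => F i t) z.
Proof.
induction n as [|n IH]; intros F t z H; [simpl; now rewrite H|].
simpl; rewrite <- seq_shift, map_map.
rewrite (IH (fun i => F (S i))) by exact H; reflexivity.
Qed.

(** [csym] on polynomial expressions, since [hilbert_basis] speaks of expressions. *)
Fixpoint psym (s : list cpoly) (i : nat) : cpoly :=
  match s, i with
  | nil, O => PC (RtoC 1)
  | nil, S _ => PC (RtoC 0)
  | a :: s, O => PMul (PMul (PC (RtoC (-1))) a) (psym s 0)
  | a :: s, S i => PAdd (psym s i) (PMul (PMul (PC (RtoC (-1))) a) (psym s (S i)))
  end.

Lemma peval_psym x s i : peval x (psym s i) = csym (map (peval x) s) i.
Proof.
revert i; induction s as [|a s IH]; intros [|i]; try reflexivity.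
- simpl; rewrite IH; reflexivity.
- simpl; rewrite !IH; reflexivity.
Qed.

Lemma pvars_lt_psym d s : Forall (pvars_lt d) s -> forall i, pvars_lt d (psym s i).
Proof.
induction 1 as [|a s Ha _ IH]; intros [|i]; simpl; auto.
Qed.

Fixpoint psubst (s : nat -> cpoly) (p : cpoly) : cpoly :=
  match p with
  | PC c => PC c
  | PX i => s i
  | PAdd p q => PAdd (psubst s p) (psubst s q)
  | PMul p q => PMul (psubst s p) (psubst s q)
  end.

Lemma peval_psubst x s p : peval x (psubst s p) = peval (fun i => peval x (s i)) p.
Proof. induction p; simpl; congruence. Qed.

Lemma pvars_lt_psubst d s p : (forall i, pvars_lt d (s i)) -> pvars_lt d (psubst s p).
Proof. intros Hs; induction p; simpl; auto. Qed.

Lemma peval_ext d x y p : pvars_lt d p ->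
  (forall i, is_true (ssrnat.leq (S i) d) -> x i = y i) -> peval x p = peval y p.
Proof.
intros Hp H; induction p; simpl in *; auto; destruct Hp; f_equal; auto.
Qed.

Lemma cpx_peval P d (x : R -> nat -> Cplx) p : subalg P -> pvars_lt d p ->
  (forall j, is_true (ssrnat.leq (S j) d) -> cpx P (fun t => x t j)) ->
  cpx P (fun t => peval (x t) p).
Proof.
intros HP Hp Hx; induction p as [c|i|p IHp q IHq|p IHp q IHq]; simpl in *.
- now apply cpx_const.
- now apply Hx.
- exact (cpx_plus _ _ _ HP (IHp (proj1 Hp)) (IHq (proj2 Hp))).
- exact (cpx_mult _ _ _ HP (IHp (proj1 Hp)) (IHq (proj2 Hp))).
Qed.

Fixpoint plin (a : nat -> Cplx) (m : nat) : cpoly :=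
  match m with
  | O => PC C0
  | S m => PAdd (plin a m) (PMul (PC (a m)) (PX m))
  end.

Lemma peval_plin x a m : peval x (plin a m) = Csum m (fun j => Cmul (a j) (x j)).
Proof. induction m as [|m IH]; simpl; [reflexivity|now rewrite IH]. Qed.

Lemma root_prod_rprod fs t z : root_prod fs t z = rprod (map (fun g => g t) fs) z.
Proof. induction fs as [|g fs IH]; simpl; [reflexivity|now rewrite IH]. Qed.

Lemma rprod_root s z : In z s -> rprod s z = 0%C.
Proof.
induction s as [|a s IH]; simpl; [easy|]; intros [->|H]; [ring|].
rewrite IH by easy; ring.
Qed.

(* Orbits of the finite group *)
From mathcomp Require Import all_boot all_fingroup.
From Stdlib Require Import Reals Rtopology.
Local Close Scope R_scope.

Lemma pvars_lt_plin d a m : (m <= d)%N -> pvars_lt d (plin a m).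
Proof.
elim: m => //= m IH Hm; split; first by apply: IH; apply: ltnW.
by split.
Qed.

Lemma In_mem (T : eqType) (s : seq T) x : In x s <-> x \in s.
Proof.
elim: s => [|a s IH] /=; first by [].
rewrite in_cons; split.
- by case=> [->|/IH ->]; rewrite ?eqxx ?orbT.
- by case/orP=> [/eqP ->|/IH]; [left|right].
Qed.

Lemma uniq_NoDup (T : eqType) (s : seq T) : uniq s -> NoDup s.
Proof.
elim: s => [|a s IH] /=; first by constructor.
case/andP=> Ha Hs; constructor; last exact: IH.
by move/In_mem; apply/negP.
Qed.

Lemma enum_mulg_permutation (gT : finGroupType) (g : gT) :
  Permutation (List.map (fun k => (k * g)%g) (enum gT)) (enum gT).
Proof.
have Hnd : NoDup (enum gT) by apply: uniq_NoDup; exact: enum_uniq.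
apply: NoDup_Permutation => //.
- apply: NoDup_map_NoDup_ForallPairs => // a b _ _ H; exact: (mulIg g).
- move=> x; split=> _; first by apply/In_mem; rewrite mem_enum.
  apply/in_map_iff; exists (x * g^-1)%g; split; first by rewrite mulgKV.
  by apply/In_mem; rewrite mem_enum.
Qed.

(** Indexed by group elements, so that coinciding values keep their multiplicity and the degree does
    not depend on t. *)
Definition orbit_values {gT : finGroupType} (d : nat) (rho : gT -> nat -> nat -> Cplx)
  (lam : cpoly) (cbar : R -> nat -> Cplx) : list (R -> Cplx) :=
  List.map (fun (k : gT) t => peval (Defs.act d rho k (cbar t)) lam) (enum gT).

(** The coefficients are symmetric in the orbit, hence invariant, hence polynomials in the
    generators, whose values along [cbar] are the components of [c]. *)
Lemma orbit_poly (gT : finGroupType) d n (rho : gT -> nat -> nat -> Cplx) sigma M r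
    (c cbar : R -> nat -> Cplx) lam :
  weight M -> linear_action d rho -> hilbert_basis d rho n sigma ->
  (forall j, (j < n)%N -> cpx (cm M r) (fun t => c t j)) ->
  (forall t, (Rabs t < r)%R -> forall j, (j < n)%N -> peval (cbar t) (sigma j) = c t j) ->
  pvars_lt d lam ->
  exists l, Forall (cpx (cm M r)) l /\
    forall t z, ev (zmonic l) t z = root_prod (orbit_values d rho lam cbar) t z.
Proof.
move=> HM [_ Hmul] [_ Hgen] Hc Hsig Hlam.
rewrite /orbit_values; move: (enum gT) (enum_mulg_permutation gT) => E HE.
pose rt (k : gT) := psubst (fun i => plin (rho k i) d) lam.
have Ert k x : peval x (rt k) = peval (Defs.act d rho k x) lam.
  rewrite /rt peval_psubst; congr (peval _ lam).
  by apply: functional_extensionality => i; rewrite peval_plin.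
pose s := List.map rt E.
have Hs : Forall (pvars_lt d) s.
  apply/Forall_forall => p /in_map_iff [k [<- _]].
  by apply: pvars_lt_psubst => i; apply: pvars_lt_plin.
have Hinv i : Defs.invariant d rho (psym s i).
  split; first exact: pvars_lt_psym.
  move=> g x; rewrite !peval_psym /s !map_map.
  (* k(gx) = (kg)x turns the action of g into right translation of the index, which only permutes
     the roots. *)
  transitivity (csym (List.map (fun k => peval x (rt k))
                        (List.map (fun k => (k * g)%g) E)) i).
    rewrite map_map; congr (csym _ i); apply: map_ext => k; rewrite !Ert.
    by apply: (peval_ext d) => // j Hj; rewrite Hmul.
  by apply: csym_permutation; apply: Permutation_map; apply: HE.
pose F i t := peval (cbar t) (psym s i).
have HF i : cpx (cm M r) (F i).
  have [q [Hq Eq]] := Hgen _ (Hinv i).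
  apply: (cpx_ext_cm M r (fun t => peval (c t) q)).
    move=> t Ht; rewrite /F Eq; apply: (peval_ext n) => // j Hj.
    by rewrite Hsig.
  by apply: (cpx_peval _ n) => //; exact: subalg_cm.
exists (List.map F (List.seq 0 (length s))); split.
  by apply/Forall_forall => g /in_map_iff [i [<- _]].
move=> t z.
have EF : (fun i => F i t) = csym (List.map (peval (cbar t)) s).
  by apply: functional_extensionality => i; rewrite /F peval_psym.
have El : length s = length (List.map (peval (cbar t)) s) by rewrite length_map.
rewrite ev_zmonic_pv; last first.
  have -> : F (length s) t = csym (List.map (peval (cbar t)) s) (length s) by rewrite -EF.
  by rewrite El; apply: (csym_top _).1.
rewrite EF El pv_csym root_prod_rprod /s !map_map.
by congr (rprod _ z); apply: map_ext => k; rewrite Ert.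
Qed.

Lemma coordinate_cm (gT : finGroupType) d n (rho : gT -> nat -> nat -> Cplx) sigma M r
    (c cbar : R -> nat -> Cplx) i :
  weight M -> ratio_diverges M -> (0 < r)%R ->
  linear_action d rho -> hilbert_basis d rho n sigma ->
  (forall j, (j < n)%N -> cpx (cm M r) (fun t => c t j)) ->
  (forall j, (j < d)%N -> cpx (smooth r) (fun t => cbar t j)) ->
  (forall t, (Rabs t < r)%R -> forall j, (j < n)%N -> peval (cbar t) (sigma j) = c t j) ->
  (i < d)%N ->
  exists r', (0 < r' <= r)%R /\ cpx (cm M r') (fun t => cbar t i).
Proof.
move=> HM Hdiv Hr Hact Hhil Hc Hcb Hsig Hi.
(* The identity element contributes the value of [lam] at [cbar] itself to the orbit. *)
have Hroot lam : pvars_lt d lam -> forall t,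
    rprod (List.map (fun g => g t) (orbit_values d rho lam cbar)) (peval (cbar t) lam) = RtoC 0.
  move=> Hlam t; apply: rprod_root; rewrite /orbit_values map_map.
  apply/in_map_iff; exists 1%g; split; last by apply/In_mem; rewrite mem_enum.
  by apply: (peval_ext d) => // j Hj; rewrite Hact.1.
have [l [Hl El]] := orbit_poly gT d n rho sigma M r c cbar (PX i) HM Hact Hhil Hc Hsig Hi.
apply: (smooth_root_cm M r l _ (orbit_values d rho (PX i) cbar)) => //.
- exact: Hcb.
- apply/Forall_forall => g /in_map_iff [k [<- _]] /=.
  have -> : (fun t => Defs.act d rho k (cbar t) i) = (fun t => peval (cbar t) (plin (rho k i) d)).
    by apply: functional_extensionality => t; rewrite peval_plin.
  by apply: (cpx_peval _ d) => //; [exact: subalg_smooth|exact: pvars_lt_plin].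
- by move=> t Ht; rewrite El root_prod_rprod; exact: (Hroot (PX i) Hi t).
- apply/Forall_forall => g /in_map_iff [k [<- _]] /=.
  (* The difference f - f_k is itself the value of a linear form at [cbar], so the orbit
     construction makes it a root of a monic polynomial over C^M. *)
  pose lam := PAdd (PX i) (PMul (PC (RtoC (-1))) (plin (rho k i) d)).
  have Hlam : pvars_lt d lam by split=> //; split=> //; exact: pvars_lt_plin.
  have [l' [Hl' El']] := orbit_poly gT d n rho sigma M r c cbar lam HM Hact Hhil Hc Hsig Hlam.
  exists l'; split=> // t Ht.
  have -> : (cbar t i + - Defs.act d rho k (cbar t) i)%C = peval (cbar t) lam.
    rewrite /lam /= peval_plin.
    change (cbar t i + - Defs.act d rho k (cbar t) i = cbar t i + RtoC (-1) * Defs.act d rho k (cbar t) i)%C.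
    by ring.
  by rewrite El' root_prod_rprod; exact: Hroot.
Qed.

Theorem theorem7p1 (gT : finGroupType) (d n : nat)
  (rho : gT -> nat -> nat -> Cplx) (sigma : nat -> cpoly) (M : nat -> R)
  (c cbar : R -> nat -> Cplx) :
  linear_action d rho ->
  hilbert_basis d rho n sigma ->
  DC_weight M -> quasianalytic M ->
  forall eps : R, (0 < eps)%R ->
  CM_vec M (sym_interval eps) n c ->
  Cinf_vec (sym_interval eps) d cbar ->
  (forall t : R, sym_interval eps t ->
     forall j : nat, (j < n)%N -> peval (cbar t) (sigma j) = c t j) ->
  exists delta : R, (0 < delta)%R /\ CM_vec M (sym_interval delta) d cbar.
Proof.
move=> Hact Hhil HDC Hqa eps Heps Hc Hcb Hsig.
have HM := DC_weight_weight M HDC.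
have Hdiv := quasianalytic_ratio_diverges M HM Hqa.
(* [CM_on] bounds derivatives on compact sets only; the interval of half the radius lies in one. *)
have Hr : (0 < eps / 2)%R by lra.
have Hcm j : (j < n)%N -> cpx (cm M (eps / 2)) (fun t => c t j).
  by move=> Hj; have [H1 H2] := Hc j Hj; split; apply: CM_on_cm.
have Hsm j : (j < d)%N -> cpx (smooth (eps / 2)) (fun t => cbar t j).
  move=> Hj; have [H1 H2] := Hcb j Hj.
  by split; apply: (smooth_le eps); try lra; apply: Cinf_on_smooth.
have Hsig' t : (Rabs t < eps / 2)%R ->
    forall j, (j < n)%N -> peval (cbar t) (sigma j) = c t j.
  by move=> Ht; apply: Hsig; apply/sym_interval_Rabs; lra.
have H m : (m <= d)%N -> exists delta, (0 < delta)%R /\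
    forall j, (j < m)%N -> cpx (cm M delta) (fun t => cbar t j).
  elim: m => [|m IH] Hm; first by exists 1%R; split; [lra|].
  have [d1 [Hd1 H1]] := IH (ltnW Hm).
  have [d2 [Hd2 H2]] := coordinate_cm gT d n rho sigma M _ c cbar m HM Hdiv Hr Hact Hhil
    Hcm Hsm Hsig' Hm.
  have Hl := Rmin_l d1 d2; have Hrr := Rmin_r d1 d2.
  exists (Rmin d1 d2); split; first by apply: Rmin_pos => //; lra.
  move=> j; rewrite ltnS leq_eqVlt => /orP [/eqP ->|Hj].
  - by apply: (cpx_imp (cm M d2)) => // g; apply: cm_le.
  - by apply: (cpx_imp (cm M d1)); [move=> g; apply: cm_le|exact: H1].
have [delta [Hdelta Hj]] := H d (leqnn d).
exists delta; split=> // j Hjd; have [H1 H2] := Hj j Hjd.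
by split; apply: cm_CM_on.
Qed.
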